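(* Let $K$ be an algebraically closed field of characteristic $0$ and let $C\subset\mathbb{P}^2$ be a smooth plane curve over $K$ of degree $d\ge 4$. Then we have the following. (1) $\sum_{n\ge 3}\delta'[n](n-2)\le 3(d-2)$. (2) Let $n\ge 2$ be an integer. If $(n+1)(n-2)>3(d-2)$, then $\delta'[\ge n]\le 3$.
   Context: For $P\in\mathbb{P}^2$, $\pi_P:C\dashrightarrow\mathbb{P}^1$ is the projection from $P$, and $G[P]=\{\tau\in\mathrm{Bir}(C)\mid \pi_P\circ\tau=\pi_P\}$. $P$ is called quasi-Galois if $|G[P]|\ge 2$. For an integer $n\ge 2$, $\delta'[n]$ (resp. $\delta'[\ge n]$) denotes the number of quasi-Galois points $P\in\mathbb{P}^2\setminus C$ with $|G[P]|=n$ (resp. $|G[P]|\ge n$). *)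

(* Defs.v *)
From HB Require Import structures.
From mathcomp Require Import all_boot all_order all_algebra.
(* mpoly must be loaded before the analysis library: in the other order the
   grammar levels of their notations clash. *)
From mathcomp Require Import mpoly.
From mathcomp Require Import all_classical all_reals all_analysis.

Set Implicit Arguments.
Unset Strict Implicit.
Unset Printing Implicit Defensive.

Import Order.TTheory GRing.Theory Num.Theory.

Local Open Scope classical_set_scope.
Local Open Scope card_scope.
Local Open Scope ring_scope.

(* A point of the projective plane is a line through the origin of K^3, so that
   equality of points is Leibniz equality. *)
Definition ppoint (K : fieldType) := {P : {vspace 'rV[K]_3} | \dim P == 1%N}.
HB.instance Definition _ (K : fieldType) := Choice.on (ppoint K).

Definition coords (K : fieldType) (P : ppoint K) : 'rV[K]_3 := vpick (val P).

Lemma coords_neq0 (K : fieldType) (P : ppoint K) : coords P != 0.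
Proof.
rewrite /coords vpick0; apply/eqP => P0.
by have := valP P; rewrite /= P0 dimv0.
Qed.

Section PlaneCurve.
Variable K : fieldType.
Implicit Types (F h : {mpoly K[3]}) (v : 'rV[K]_3) (P : ppoint K).

Definition on_curve F P : Prop := F.@[coords P ord0] = 0.

(* Smoothness forces the curve to be reduced and irreducible, when K is
   algebraically closed; neither has to be assumed. *)
Definition smooth_plane_curve (d : nat) F : Prop :=
  [/\ F != 0, F \is d.-homog &
      forall v, v != 0 -> F.@[v ord0] = 0 ->
        exists i : 'I_3, (F^`M(i)).@[v ord0] != 0].

Definition vanishes_on F h : Prop :=
  forall v, v != 0 -> F.@[v ord0] = 0 -> h.@[v ord0] = 0.

(* Representatives (f_0 : ... : f_m) of the rational maps from the curve F = 0
   to the projective space of dimension m. *)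
Definition ratrep F (m : nat) (f : m.+1.-tuple {mpoly K[3]}) : Prop :=
  (exists e : nat, forall i, tnth f i \is e.-homog) /\
  (exists i, ~ vanishes_on F (tnth f i)).

(* The condition that f and g be valid representatives is essential: the zero
   tuple is proportional to everything. *)
Definition rat_eq F (m : nat) (f g : m.+1.-tuple {mpoly K[3]}) : Prop :=
  [/\ ratrep F f, ratrep F g &
      forall i j,
        vanishes_on F (tnth f i * tnth g j - tnth f j * tnth g i)].

(* A rational map proper is a class of representatives. *)
Definition ratmap F (m : nat) (f : m.+1.-tuple {mpoly K[3]}) :
  set (m.+1.-tuple {mpoly K[3]}) := [set g | rat_eq F f g].

Definition rat_comp (m : nat) (f : m.+1.-tuple {mpoly K[3]})
    (g : 3.-tuple {mpoly K[3]}) : m.+1.-tuple {mpoly K[3]} :=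
  [tuple (tnth f i) \mPo g | i < m.+1].

Definition rat_id : 3.-tuple {mpoly K[3]} := [tuple 'X_i | i < 3].

Definition ratself F (f : 3.-tuple {mpoly K[3]}) : Prop :=
  ratrep F f /\ vanishes_on F (F \mPo f).

Definition birational F (f : 3.-tuple {mpoly K[3]}) : Prop :=
  ratself F f /\
  exists g, [/\ ratself F g, rat_eq F (rat_comp g f) rat_id
              & rat_eq F (rat_comp f g) rat_id].

Definition Bir F : set (set (3.-tuple {mpoly K[3]})) :=
  [set tau | exists2 f, birational F f & tau = ratmap F f].

Lemma proj_mx_ex P :
  exists A : 'M[K]_(3, 2), (\rank A == 2%N) && (coords P *m A == 0).
Proof.
move: (coords P) (coords_neq0 P) => v v0.
set C := cokermx v.
have rk : \rank C = 2%N by rewrite mxrank_coker rank_rV v0.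
have vC : v *m col_base C = 0.
  apply: (row_free_inj (row_base_free C)).
  by rewrite -mulmxA mulmx_base mulmx_coker mul0mx.
have fC : \rank (col_base C) = \rank C by apply/eqP; apply: col_base_full.
move: (col_base C) vC fC; rewrite rk => A vA rA.
by exists A; rewrite rA vA !eqxx.
Qed.

(* Two independent linear forms vanishing at P. The choice is irrelevant: another
   one changes the projection by an automorphism of the target line. *)
Definition proj_mx P : 'M[K]_(3, 2) := xchoose (proj_mx_ex P).

Definition proj P : 2.-tuple {mpoly K[3]} :=
  [tuple \sum_(i < 3) proj_mx P i j *: 'X_i | j < 2].

Definition galois_group F P : set (set (3.-tuple {mpoly K[3]})) :=
  [set tau | Bir F tau /\
    exists2 f, tau f & rat_eq F (rat_comp (proj P) f) (proj P)].

Definition quasi_galois F P : Prop := `I_2 #<= galois_group F P.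

(* The numbers delta'[n] and delta'[>= n], as extended reals so as not to
   presuppose finiteness. *)
Definition delta' (R : realType) F (n : nat) : \bar R :=
  counting [set P : ppoint K |
    [/\ quasi_galois F P, ~ on_curve F P & galois_group F P #= `I_n]].

Definition delta'_ge (R : realType) F (n : nat) : \bar R :=
  counting [set P : ppoint K |
    [/\ quasi_galois F P, ~ on_curve F P & `I_n #<= galois_group F P]].

End PlaneCurve.

(* Main.v *)
(* Let P be a point outside C, and X, Y, Z coordinates in which P = (1 : 0 : 0).
   For an element of G[P], the pullback of X / Z is integral over the functions
   of the target line of the projection. As a smooth plane curve is
   projectively normal, it comes from a linear form, so that G[P] consists of
   linear maps (aX + bY + cZ : Y : Z). Here a determines b and c, and G[P] is
   cyclic, generated by a homology with center P and some axis l = 0, of order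
   n = |G[P]|. Invariance of F makes l^(n-1) divide the derivative of F in the
   direction of P, hence l^(n-2) divides the determinant of the Hessian matrix.
   This determinant is a nonzero form of degree 3(d-2), and distinct centers
   have distinct axes: (1) follows without counting flexes on C. As to (2), if
   P' were not on the axis of P, the orbit of P' under G[P] and P itself would be
   n + 1 points whose groups have order at least n, against (1). So each center
   lies on the axes of the others, which leaves room for three centers only. *)
Require Import Defs.
From mathcomp Require Import all_boot all_order all_algebra.
From mathcomp Require Import perm cyclic separable finmap.
From mathcomp Require Import mpoly ring zify.
From mathcomp Require Import all_classical all_reals all_analysis.

Set Implicit Arguments.
Unset Strict Implicit.
Unset Printing Implicit Defensive.

Import Order.TTheory GRing.Theory Num.Theory.

Local Open Scope ring_scope.
Local Open Scope card_scope.

(** * Generic values of the parameter *)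

Section Generic.
Variable K : closedFieldType.
Implicit Types (P Q : K -> Prop) (c : {poly K}).

(** Projective normality is obtained by elementary means. Scaling a vector of [P] so that [F] is 1
    there makes [F] monic in the coordinate [x] along the lines through [P]. With [t] a parameter of
    these lines, the curve becomes a monic equation over [K[t]], in two charts exchanged by
    [t -> 1 / t]. A denominator in [t] of an integral function is removed one factor [t - a] at a
    time, smoothness entering through the two partial derivatives; gluing the charts then bounds
    degrees. For an element of the group the integral equation is that of the curve itself, since
    the image of a point stays on its line through [P]. Two obstacles shape the statements. A
    representative of a rational map may vanish at some points of the curve, so identities are known
    for almost all [t] only ([generic]); monicity extends them to all points. And irreducibility is
    not given, so a form could a priori vanish on one component only; this is excluded by showing
    that the indicator of its nonvanishing is regular in both charts. *)

Definition generic P := exists2 c, c != 0 & forall t, c.[t] != 0 -> P t.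

Lemma generic_mono P Q : (forall t, P t -> Q t) -> generic P -> generic Q.
Proof. by move=> PQ [c c0 cP]; exists c => // t /cP/PQ. Qed.

Lemma generic_and P Q : generic P -> generic Q -> generic (fun t => P t /\ Q t).
Proof.
move=> [c c0 cP] [e e0 eQ]; exists (c * e); first by rewrite mulf_neq0.
by move=> t; rewrite hornerM mulf_eq0 negb_or => /andP[/cP ? /eQ ?].
Qed.

Lemma generic_all P : (forall t, P t) -> generic P.
Proof. by move=> PT; exists 1 => //; apply: oner_neq0. Qed.

Lemma generic_poly c : c != 0 -> generic (fun t => c.[t] != 0).
Proof. by exists c. Qed.

Lemma generic_ex P : generic P -> exists t, P t.
Proof.
move=> [c /closed_nonrootP[t ct] cP]; exists t; exact: cP.
Qed.

Lemma generic_neq0 : generic (fun t => t != 0).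
Proof. by exists 'X; [rewrite polyX_eq0 | move=> t; rewrite hornerX]. Qed.

(** The reciprocal polynomial: it clears the denominators of [c.[t^-1]], so that genericity survives
    the change of chart. *)
Definition rev_poly c : {poly K} := \poly_(i < size c) c`_((size c).-1 - i).

Lemma horner_rev_poly c t : t != 0 ->
  (rev_poly c).[t] = t ^+ (size c).-1 * c.[t^-1].
Proof.
move=> t0; rewrite horner_poly horner_coef mulr_sumr.
rewrite (reindex_inj rev_ord_inj) /=; apply: eq_bigr => i _.
have il : (i <= (size c).-1)%N by rewrite -ltnS prednK // (leq_ltn_trans _ (ltn_ord i)).
have -> : (size c - i.+1 = (size c).-1 - i)%N by rewrite -subn1 -subnDA add1n.
by rewrite subKn // mulrCA exprVn -expfB_cond ?(negPf t0).
Qed.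

Lemma rev_poly_neq0 c : c != 0 -> rev_poly c != 0.
Proof.
move=> c0; apply/eqP=> /(congr1 (fun p : {poly K} => p`_0)).
rewrite coef_poly size_poly_gt0 c0 subn0 coef0 => /eqP.
by rewrite lead_coef_eq0 (negPf c0).
Qed.

Lemma generic_inv P : generic P -> generic (fun t => P t^-1).
Proof.
move=> [c c0 cP].
apply: generic_mono (generic_and (generic_poly (rev_poly_neq0 c0)) generic_neq0).
move=> t [ct t0]; apply: cP; apply: contra ct => /eqP ct.
by rewrite horner_rev_poly // ct mulr0.
Qed.

Lemma generic_eq0 c : generic (fun t => c.[t] = 0) -> c = 0.
Proof.
move=> gc; apply/eqP; apply: contraT => /generic_poly/(generic_and gc)/generic_ex[t []->].
by rewrite eqxx.
Qed.

End Generic.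

(** * Plane curves fibred over the affine line *)

Lemma separable_polyE (R : idomainType) (p : {poly R}) :
  separable_poly p = coprimep p p^`().
Proof. by rewrite separable_poly.unlock. Qed.

Section PlanarCurve.
Variable K : closedFieldType.
Hypothesis charK0 : [pchar K] =i pred0.
Implicit Types (f g h : {poly {poly K}}) (c : {poly K}).

(** The outer variable of [h] is [x], the inner one [t]; this is the restriction of [h] to the fibre
    over [t]. *)
Definition spec (t : K) h : {poly K} := map_poly (horner_eval t) h.

Lemma horner_spec t h x : (spec t h).[x] = h.[x%:P].[t].
Proof.
rewrite /spec -{1}[x](hornerC x t) -[x%:P.[t]]/(horner_eval t x%:P).
by rewrite horner_map.
Qed.

Lemma specM t g h : spec t (g * h) = spec t g * spec t h.
Proof. exact: rmorphM. Qed.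

Lemma specD t g h : spec t (g + h) = spec t g + spec t h.
Proof. exact: rmorphD. Qed.

Lemma specB t g h : spec t (g - h) = spec t g - spec t h.
Proof. exact: rmorphB. Qed.

Lemma specC t c : spec t c%:P = (c.[t])%:P.
Proof. exact: map_polyC. Qed.

Lemma specK t (p : {poly K}) : spec t (map_poly polyC p) = p.
Proof.
by apply/polyP=> i; rewrite /spec !coef_map /= /horner_eval hornerC.
Qed.

Lemma spec_deriv t h : spec t h^`() = (spec t h)^`().
Proof. by rewrite /spec deriv_map. Qed.

Lemma coef_spec t h i : (spec t h)`_i = (h`_i).[t].
Proof. by rewrite coef_map. Qed.

Lemma size_spec_le t h : (size (spec t h) <= size h)%N.
Proof. exact: size_poly. Qed.

Lemma size_spec t h : (lead_coef h).[t] != 0 -> size (spec t h) = size h.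
Proof. by move=> nz; rewrite size_map_poly_id0. Qed.

Lemma generic_spec_eq0 h : generic (fun t => spec t h = 0) -> h = 0.
Proof.
move=> gh; apply/polyP=> i; rewrite coef0; apply: generic_eq0.
by apply: generic_mono gh => t ht; rewrite -coef_spec ht coef0.
Qed.

Lemma spec_eq0_dvd t h : spec t h = 0 -> exists h', h = ('X - t%:P)%:P * h'.
Proof.
move=> ht; exists (\poly_(i < size h) divp (nth 0 h i) ('X - t%:P)).
apply/polyP=> i; rewrite coefCM coef_poly; case: ltnP => [_|?]; last first.
  by rewrite mulr0 nth_default.
rewrite mulrC divpK // dvdp_XsubCl; apply/rootP.
by rewrite -coef_spec ht coef0.
Qed.

Lemma natr_polyK_neq0 (n : nat) (a : {poly K}) : a != 0 -> a *+ n.+1 != 0.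
Proof.
move=> a0; rewrite -scaler_nat scaler_eq0 (negPf a0) orbF.
by have /pcharf0P -> := charK0.
Qed.

Lemma deriv_neq0 h : (1 < size h)%N -> h^`() != 0.
Proof.
case sh : (size h) => [//|[//|n]] _.
have: h`_n.+1 != 0 by rewrite -[n.+1]/(n.+2.-1) -sh lead_coef_eq0 -size_poly_eq0 sh.
move/(natr_polyK_neq0 n); apply: contra => /eqP h'0.
by rewrite -coef_deriv h'0 coef0.
Qed.

Definition affine_smooth f := forall x t, f.[x%:P].[t] = 0 ->
  f^`().[x%:P].[t] != 0 \/ (f.[x%:P])^`().[t] != 0.

Lemma affine_smoothP f x t : affine_smooth f -> f.[x%:P].[t] = 0 ->
  f^`().[x%:P].[t] = 0 -> (f.[x%:P])^`().[t] != 0.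
Proof. by move=> sf f0 f'0; case: (sf x t f0) => //; rewrite f'0 eqxx. Qed.

(** * Functions on a smooth affine curve that is monic over the line *)

Section Curve.
Variable f : {poly {poly K}}.
Hypothesis fmon : f \is monic.
Hypothesis fsm : affine_smooth f.

Let f_neq0 : f != 0. Proof. exact: monic_neq0. Qed.

Lemma spec_monic t : spec t f \is monic.
Proof. exact: monic_map. Qed.

Lemma size_specf t : size (spec t f) = size f.
Proof. by rewrite size_spec // (monicP fmon) hornerC oner_neq0. Qed.

(** At a zero of a repeated factor [g] both partial derivatives of [f] vanish, against smoothness.
    Divisibility over [K[t]] is up to a factor [c], so the zero is taken over a [t] where neither
    [c] nor the leading coefficient of [g] vanishes. *)
Lemma separable_curve : separable_poly f.
Proof.
apply/separable_polyP; split => [u v uvf|u _ /deriv_neq0 //].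
rewrite coprimep_def; apply: contraT => sg.
set g := gcdp u v in sg.
have : g * g %| f by apply: dvdp_trans uvf; rewrite dvdp_mul ?dvdp_gcdl ?dvdp_gcdr.
move=> /Pdiv.Idomain.dvdpP[[c q] /= c0 cf].
have g0 : g != 0.
  apply: contra_neq c0 => g0; apply/eqP; move/eqP: cf.
  by rewrite g0 !mulr0 scale_poly_eq0 (negPf f_neq0) orbF.
have [t [ct gt]] := generic_ex (generic_and (generic_poly c0)
  (generic_poly (c := lead_coef g) (etrans (congr1 negb (lead_coef_eq0 _)) g0))).
have sgt : size (spec t g) != 1 by rewrite size_spec.
have /closed_rootP[x /rootP gx] := sgt.
rewrite horner_spec in gx.
have fx : f.[x%:P].[t] = 0.
  have := congr1 (fun h => h.[x%:P].[t]) cf; rewrite /= !(hornerZ, hornerM) gx !mulr0.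
  by move/eqP; rewrite mulf_eq0 (negPf ct) => /eqP.
have [] := fsm fx.
  have := congr1 (fun h => h^`().[x%:P].[t]) cf.
  rewrite derivZ !derivM !(hornerD, hornerM, hornerZ) gx !(mulr0, mul0r, addr0).
  by move/eqP; rewrite mulf_eq0 (negPf ct) /= => ->.
have := congr1 (fun h => (h.[x%:P])^`().[t]) cf.
rewrite /= hornerZ !hornerM !derivM !(hornerD, hornerM) gx fx !(mulr0, mul0r, addr0, add0r).
by move/eqP; rewrite mulf_eq0 (negPf ct) /= => ->.
Qed.

Lemma generic_separable : generic (fun t => separable_poly (spec t f)).
Proof.
have := separable_curve; rewrite separable_polyE => /Bezout_coprimepP[[u v] /=].
rewrite -size_poly_eq1 => /size_poly1P[c c0 E].
apply: generic_mono (generic_poly c0) => t ct.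
rewrite separable_polyE; apply/Bezout_coprimepP; exists (spec t u, spec t v) => /=.
by rewrite -spec_deriv -!specM -specD E specC -size_poly_eq1 size_polyC ct.
Qed.

Lemma generic_roots : generic (fun t => exists r : seq K,
  [/\ uniq r, size r = (size f).-1 & spec t f = \prod_(z <- r) ('X - z%:P)]).
Proof.
apply: generic_mono generic_separable => t.
have [r] := closed_field_poly_normal (spec t f).
rewrite (monicP (spec_monic t)) scale1r => E; rewrite E separable_prod_XsubC => ur.
by exists r; split=> //; rewrite -(size_specf t) E size_prod_XsubC.
Qed.

Definition on_f x t := f.[x%:P].[t] = 0.

Lemma modf g : exists q r, g = q * f + r /\ (size r < size f)%N.
Proof.
exists (Pdiv.Ring.rdivp g f), (Pdiv.Ring.rmodp g f); split.
  exact: Pdiv.RingMonic.rdivp_eq.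
by rewrite Pdiv.Ring.ltn_rmodp.
Qed.

(** The remainder modulo [f] has smaller degree in [x] than the number of points of a generic fibre,
    so it vanishes identically there. *)
Lemma vanish_dvd h : generic (fun t => forall x, on_f x t -> h.[x%:P].[t] = 0) ->
  exists q, h = q * f.
Proof.
have [q [r [-> sr]]] := modf h => gh; exists q.
suff -> : r = 0 by rewrite addr0.
apply: generic_spec_eq0.
apply: generic_mono (generic_and gh generic_roots) => t [ht [rs [urs srs E]]].
apply/eqP; apply: contraT => r0.
suff : (size rs < size (spec t r))%N.
  rewrite srs => /leq_trans/(_ (size_spec_le _ _)).
  by rewrite ltnNge -ltnS prednK ?sr // size_poly_gt0.
apply: max_poly_roots => //; apply/allP => x xrs; apply/rootP.
have fx : on_f x t.
  by rewrite /on_f -horner_spec E; apply/rootP; rewrite root_prod_XsubC.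
have := ht x fx.
by rewrite hornerD hornerM hornerD hornerM fx mulr0 add0r horner_spec.
Qed.

Lemma vanish_generic h :
  generic (fun t => forall x, on_f x t -> h.[x%:P].[t] = 0) ->
  forall x t, on_f x t -> h.[x%:P].[t] = 0.
Proof.
by move=> /vanish_dvd[q ->] x t fx; rewrite hornerM hornerM fx mulr0.
Qed.

(* [E ^ N * Q(A / E)], where [N] is the degree of [Q]. *)
Definition homog_sub (Q A E : {poly {poly K}}) : {poly {poly K}} :=
  \sum_(i < size Q) (Q`_i)%:P * A ^+ i * E ^+ ((size Q).-1 - i).

Lemma homog_subE Q A E x t : (homog_sub Q A E).[x%:P].[t] =
  \sum_(i < size Q) (Q`_i).[t] * A.[x%:P].[t] ^+ i * E.[x%:P].[t] ^+ ((size Q).-1 - i).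
Proof.
rewrite /homog_sub !horner_sum; apply: eq_bigr => i _.
by rewrite !(hornerM, horner_exp, hornerC).
Qed.

Lemma homog_sub_ratio Q A E x t z : A.[x%:P].[t] = E.[x%:P].[t] * z ->
  (homog_sub Q A E).[x%:P].[t] = E.[x%:P].[t] ^+ (size Q).-1 * (spec t Q).[z].
Proof.
move=> AE; rewrite homog_subE AE; set e := _.[t].
have -> : (spec t Q).[z] = \sum_(i < size Q) (Q`_i).[t] * z ^+ i.
  rewrite (horner_coef_wide _ (size_spec_le t Q)).
  by apply: eq_bigr => i _; rewrite coef_spec.
rewrite mulr_sumr; apply: eq_bigr => i _.
have il : (i <= (size Q).-1)%N by rewrite -ltnS prednK // (leq_ltn_trans _ (ltn_ord i)).
by rewrite exprMn -[X in _ = e ^+ X * _](subnK il) exprD; ring.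
Qed.

(** Together with [homog_sub_ratio] this says that an integral quotient has no pole: if
    [Q(A / E) = 0] generically, [homog_sub Q A E] vanishes on the curve, and at a zero of [E]
    monicity leaves a power of [A]. *)
Lemma homog_sub0 Q A E x t : Q \is monic -> E.[x%:P].[t] = 0 ->
  (homog_sub Q A E).[x%:P].[t] = A.[x%:P].[t] ^+ (size Q).-1.
Proof.
move=> Qm E0; rewrite homog_subE E0.
have sQ : (0 < size Q)%N by rewrite size_poly_gt0 monic_neq0.
rewrite -(prednK sQ) big_ord_recr /= big1 ?add0r => [|i _]; last first.
  by rewrite expr0n subn_eq0 leqNgt ltn_ord mulr0.
by rewrite subnn expr0 mulr1 -lead_coefE (monicP Qm) hornerC mul1r.
Qed.

(* Away from [t = a], the quotient of [v] by [(t - a) * D] is integral over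
   [K[t]]. If [v] does not vanish on the whole fibre over [a], counted with
   multiplicity, then multiplying by a function of [x] we may assume that [v]
   vanishes to an order exactly one less than required, at one point [(x0, a)].
   Either [v] is nonzero there, or the fibre is tangent to the curve, and then
   [v / (t - a)] has a pole. Both contradict integrality. *)
Lemma integral_step v (D : {poly K}) a Q : Q \is monic -> D != 0 ->
  generic (fun t => forall x, on_f x t ->
    (spec t Q).[v.[x%:P].[t] / ((t - a) * D.[t])] = 0) ->
  exists w, forall x t, on_f x t -> v.[x%:P].[t] = (t - a) * w.[x%:P].[t].
Proof.
move=> Qm D0 int; set f0 := spec a f; set v0 := spec a v.
have f00 : f0 != 0 by rewrite monic_neq0 ?spec_monic.
set g := gcdp f0 v0.
have /dvdpP[k fk] : g %| f0 by rewrite dvdp_gcdl.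
have /dvdpP[m vm] : g %| v0 by rewrite dvdp_gcdr.
have g0 : g != 0 by apply: contraNneq f00 => g0; rewrite fk g0 mulr0.
have [sk|sk] := eqVneq (size k) 1.
  have /dvdpP[q vq] : f0 %| v0.
    rewrite fk (eqp_dvdl _ (eqp_mulr g (_ : k %= 1))) ?mul1r ?dvdp_gcdr //.
    by rewrite -size_poly_eq1 sk.
  have [] := @spec_eq0_dvd a (v - map_poly polyC q * f).
    by rewrite specB specM specK -/v0 -/f0 vq subrr.
  move=> w E; exists w => x t fx.
  have := congr1 (fun h => h.[x%:P].[t]) E.
  rewrite /= hornerD hornerN hornerM !hornerD !hornerN !hornerM fx mulr0 subr0 => ->.
  by rewrite hornerC hornerXsubC.
have /closed_rootP[x0 /[dup] kx0 /factor_theorem[k' kk']] := sk.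
have km : coprimep k m.
  have : coprimep (f0 %/ g) (v0 %/ g) by apply: coprimep_div_gcd; rewrite f00.
  by rewrite fk vm !mulpK.
have mx0 : m.[x0] != 0 by apply: coprimep_root km kx0.
pose X0 : {poly {poly K}} := 'X - x0%:P%:P.
pose kk := map_poly (@polyC K) k'; pose mm := map_poly (@polyC K) m.
(* On the curve this reads [(x - x0) * k' * v = (t - a) * B]. Hence [B / (D * (x - x0) * k')] is the
   given integral quotient again, with a denominator vanishing at [(x0, a)]. *)
have [B EB] : exists B, X0 * v * kk - f * mm = ('X - a%:P)%:P * B.
  apply: spec_eq0_dvd; rewrite specB !specM !specK -/f0 -/v0 {1}vm fk kk'.
  rewrite specB specC hornerC /spec map_polyX; ring.
have EBx x t : on_f x t -> (x - x0) * v.[x%:P].[t] * kk.[x%:P].[t] = (t - a) * B.[x%:P].[t].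
  move=> fx; have := congr1 (fun h => h.[x%:P].[t]) EB.
  rewrite /= !(hornerD, hornerN, hornerM) fx mul0r subr0 !(hornerC, hornerX, hornerD, hornerN).
  by move=> ->.
have fx0 : on_f x0 a.
  by rewrite /on_f -horner_spec -/f0 fk hornerM (rootP kx0) mul0r.
have vk0 : v0.[x0] * k'.[x0] = 0.
  apply/eqP; rewrite mulf_eq0 horner_spec; apply: contraT; rewrite negb_or => /andP[vx0 _].
  have E0 : (('X - a%:P) * D)%:P.[x0%:P].[a] = 0.
    by rewrite hornerC hornerM hornerXsubC subrr mul0r.
  have := @vanish_generic (homog_sub Q v (('X - a%:P) * D)%:P) _ x0 a fx0.
  rewrite (homog_sub0 v Qm E0) => /(_ _)/eqP; rewrite expf_eq0 (negPf vx0) andbF; apply.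
  apply: generic_mono (generic_and int (generic_poly (mulf_neq0 (monic_neq0 (monicXsubC a)) D0))).
  move=> t [ht et] x fx; rewrite hornerM hornerXsubC in et.
  rewrite (@homog_sub_ratio _ _ _ _ _ (v.[x%:P].[t] / ((t - a) * D.[t]))).
    by rewrite ht ?mulr0.
  by rewrite hornerC hornerM hornerXsubC mulrC divfK.
have B0 : B.[x0%:P].[a] != 0.
  have : (f.[x0%:P])^`().[a] != 0.
    apply: (affine_smoothP fsm fx0).
    rewrite -horner_spec spec_deriv -/f0 fk kk' !derivM derivXsubC.
    rewrite !(hornerXsubC, hornerE) subrr.
    have /eqP : m.[x0] * (k'.[x0] * g.[x0]) = 0.
      by rewrite -vk0 vm hornerM; ring.
    rewrite mulf_eq0 (negPf mx0) => /eqP kg; rewrite -[RHS]kg; ring.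
  (* In the [t]-derivative of [EB] at [(x0, a)] only the derivative of [f] times [m.[x0]] and the
     value of [B] survive. *)
  apply: contra_neq => Bx0.
  have := congr1 (fun h => (h.[x0%:P])^`().[a]) EB.
  rewrite /= hornerD hornerN !hornerM !poly.derivE !(hornerE, hornerM, hornerD, hornerN, poly.derivE).
  rewrite -horner_spec -(horner_spec a mm) !specK fx0 Bx0 !subrr oppr0.
  rewrite !(mul0r, add0r, addr0, sub0r) => /eqP; rewrite oppr_eq0 mulf_eq0.
  by rewrite (negPf mx0) orbF => /eqP.
have E0 : (D%:P * X0 * kk).[x0%:P].[a] = 0.
  by rewrite !hornerM !(hornerC, hornerX, hornerD, hornerN) subrr mulr0 mul0r.
have := @vanish_generic (homog_sub Q B (D%:P * X0 * kk)) _ x0 a fx0.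
rewrite (homog_sub0 B Qm E0) => /(_ _)/eqP; rewrite expf_eq0 (negPf B0) andbF => H.
suff : false by []. apply: H.
apply: generic_mono (generic_and int (generic_poly (mulf_neq0 (monic_neq0 (monicXsubC a)) D0))).
move=> t [ht et] x fx; rewrite hornerM hornerXsubC in et.
rewrite (@homog_sub_ratio _ _ _ _ _ (v.[x%:P].[t] / ((t - a) * D.[t]))).
  by rewrite ht ?mulr0.
have ta : t - a != 0 by apply: contraNneq et => ->; rewrite mul0r.
apply: (mulfI ta); rewrite -EBx //.
rewrite !hornerM !(hornerC, hornerX, hornerD, hornerN) -[in LHS](divfK et v.[_].[_]).
ring.
Qed.

(** Dividing out one root of [D] at a time leaves the quotient [v / D], hence its integral equation,
    unchanged. *)
Lemma integral_dvd v (D : {poly K}) Q : Q \is monic -> D != 0 ->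
  generic (fun t => forall x, on_f x t ->
    (spec t Q).[v.[x%:P].[t] / D.[t]] = 0) ->
  exists w, forall x t, on_f x t -> v.[x%:P].[t] = D.[t] * w.[x%:P].[t].
Proof.
move=> Qm; have [n] := ubnP (size D); elim: n v D => // n IHn v D sD D0 int.
have [sD1|sD1] := eqVneq (size D) 1.
  move/eqP/size_poly1P: sD1 => [c c0 ->].
  exists (c^-1%:P%:P * v) => x t _.
  by rewrite !hornerM !hornerC mulrA divff ?mul1r.
have /closed_rootP[a /factor_theorem[D' DE]] := sD1.
have D'0 : D' != 0 by apply: contraNneq D0 => D'0; rewrite DE D'0 mul0r.
have [|v' Ev] := @integral_step v D' a Q Qm D'0.
  by apply: generic_mono int => t ht x /ht; rewrite DE hornerM hornerXsubC [D'.[t] * _]mulrC.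
have [||w Ew] := IHn v' D' _ D'0.
- by move: sD; rewrite DE size_mul ?polyXsubC_eq0 // size_XsubC addn2.
- have := generic_and int (generic_poly (monic_neq0 (monicXsubC a))).
  apply: generic_mono => t [ht ta] x fx; rewrite hornerXsubC in ta.
  rewrite -[RHS](ht x fx) Ev // DE hornerM hornerXsubC; congr (_.[_]).
  by rewrite [D'.[t] * _]mulrC -mulf_div divff // mul1r.
by exists w => x t fx; rewrite Ev // Ew // DE hornerM hornerXsubC; ring.
Qed.

(* [K(t)[x]/(f)] is a product of fields, hence von Neumann regular. *)
Lemma von_neumann_regular g : exists g' (D : {poly K}), D != 0 /\
  forall x t, on_f x t ->
    g.[x%:P].[t] * (g.[x%:P].[t] * g'.[x%:P].[t] - D.[t]) = 0.
Proof.
set d := gcdp f g.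
have /Pdiv.Idomain.dvdpP[[c1 e] /= c10 Ef] : d %| f by rewrite dvdp_gcdl.
have /Pdiv.Idomain.dvdpP[[c4 g1] /= c40 Eg] : d %| g by rewrite dvdp_gcdr.
have [[u v] /= /eqpP[[c2 c3] /= /andP[c20 c30] Euv]] := Bezoutp f g.
have : coprimep e d.
  apply: separable_coprime separable_curve _; apply/Pdiv.Idomain.dvdpP.
  by exists (c1, 1); rewrite ?mul1r.
move/Bezout_coprimepP => [[w u'] /=]; rewrite -size_poly_eq1 => /size_poly1P[c5 c50 Ewu].
(* On the curve [g * g' = c3 * u' * d], so that [g * g' - D = - c3 * w * e] by [Ewu]. Up to a factor
   in [t], [g] is a multiple of [d], and [e * d = c1 * f] vanishes. *)
exists (c2%:P * u' * v), (c3 * c5); split; first by rewrite mulf_neq0.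
move=> x t fx.
suff : (g * (g * (c2%:P * u' * v) - (c3 * c5)%:P)).[x%:P].[t] = 0.
  by rewrite !(hornerM, hornerD, hornerN, hornerC).
apply: vanish_generic fx.
apply: generic_mono (generic_and (generic_poly c40) (generic_poly c10)) => {}t [t4 t1] {}x fx.
have ev (h1 h2 : {poly {poly K}}) : h1 = h2 -> h1.[x%:P].[t] = h2.[x%:P].[t] by move->.
move: (ev _ _ Ef) (ev _ _ Eg) (ev _ _ Euv) (ev _ _ Ewu).
rewrite !(hornerM, hornerD, hornerN, hornerC, hornerZ) fx !mulr0 add0r -/d => E1 E4 E2 E5.
apply: (mulfI t4); rewrite mulr0 [LHS]mulrA E4.
rewrite -E5.
have -> : g.[x%:P].[t] * (c2.[t] * u'.[x%:P].[t] * v.[x%:P].[t]) =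
   u'.[x%:P].[t] * (c2.[t] * (v.[x%:P].[t] * g.[x%:P].[t])) by ring.
rewrite E2; transitivity (- (g1.[x%:P].[t] * c3.[t] * w.[x%:P].[t]) * (e.[x%:P].[t] * d.[x%:P].[t])); first by ring.
by rewrite -E1 mulr0.
Qed.

End Curve.

(* [x / t] and [1 / t] are the coordinates in the second chart, where [W2] has
   no pole: this bounds the degrees of the coefficients of [W1]. *)
Lemma two_charts f1 f2 (k : nat) W1 W2 :
  f1 \is monic -> affine_smooth f1 -> f2 \is monic -> size f2 = size f1 ->
  (forall x t, t != 0 -> on_f f1 x t -> on_f f2 (x / t) t^-1) ->
  generic (fun t => forall x, on_f f1 x t ->
    W1.[x%:P].[t] = t ^+ k * W2.[(x / t)%:P].[t^-1]) ->
  exists W, (forall x t, on_f f1 x t -> W1.[x%:P].[t] = W.[x%:P].[t]) /\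
    forall i, (size (W`_i)%R <= k.+1 - i)%N.
Proof.
move=> m1 s1 m2 s12 f12 gW.
have [q1 [r1 [E1 sr1]]] := modf m1 W1.
have [q2 [r2 [E2 sr2]]] := modf m2 W2.
exists r1; split=> [x t fx|i].
  by rewrite E1 hornerD hornerM hornerD hornerM fx mulr0 add0r.
(* Coefficients of two polynomials in [x] that agree at all points of a generic fibre, and whose
   degrees are less than their number. *)
have gi : generic (fun t => (r1`_i).[t] * t ^+ i = t ^+ k * (r2`_i).[t^-1]).
  have := generic_and gW (generic_and (generic_neq0 K) (generic_roots m1 s1)).
  apply: generic_mono => t [Wt [t0 [rs [urs srs E]]]].
  pose p := spec t r1 - \poly_(i < size r2) (t ^+ k * (r2`_i).[t^-1] * t^-1 ^+ i).
  have p0 : p = 0.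
    apply/eqP; apply: contraT => p0.
    suff : (size rs < size p)%N.
      rewrite srs ltnNge => /negP[]; apply: (leq_trans (size_polyD _ _)).
      rewrite geq_max size_polyN (leq_trans (size_spec_le _ _)) ?(leq_trans (size_poly _ _)) //.
        by move: sr2; rewrite s12; lia.
      by move: sr1; lia.
    apply: max_poly_roots => //; apply/allP => x xrs; apply/rootP.
    have fx : on_f f1 x t.
      by rewrite /on_f -horner_spec E; apply/rootP; rewrite root_prod_XsubC.
    have := Wt x fx; rewrite E1 E2 !(hornerD, hornerM) fx f12 //.
    rewrite !mulr0 !add0r => EW; rewrite hornerN horner_spec EW horner_poly.
    apply/eqP; rewrite subr_eq0 -horner_spec (horner_coef_wide _ (size_spec_le _ _)).
    rewrite mulr_sumr; apply/eqP/eq_bigr => j _; rewrite coef_spec exprMn; ring.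
  have := congr1 (fun p : {poly K} => p`_i) p0.
  rewrite coefB coef0 coef_spec coef_poly => /eqP; rewrite subr_eq0 => /eqP ->.
  case: ltnP => [_|/leq_sizeP/(_ _ (leqnn _))->]; last by rewrite horner0 mulr0 mul0r.
  by rewrite exprVn divfK // expf_neq0.
set b := r2`_i in gi; set a := r1`_i in gi *.
have [->|a0] := eqVneq a 0; first by rewrite size_poly0.
(* Multiplying by [t] to the degree of [b] turns the relation into one of polynomials, and comparing
   degrees gives [deg a + i <= k]. So [a] can be nonzero for [i <= k] only, in agreement with the
   truncated subtraction of the bound. *)
have E : a * 'X^i * 'X^((size b).-1) = 'X^k * rev_poly b.
  apply/eqP; rewrite -subr_eq0; apply/eqP/generic_eq0.
  apply: generic_mono (generic_and gi (generic_neq0 K)) => t [ht t0].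
  rewrite hornerD hornerN !hornerM !hornerXn ht horner_rev_poly //; ring.
have b0 : b != 0.
  apply: contra_neq a0 => b0; move/eqP: E; rewrite b0 /rev_poly size_poly0.
  rewrite poly_def big_ord0 mulr0 !mulf_eq0 !expf_eq0 !polyX_eq0 !andbF !orbF.
  by move/eqP.
have sE : (((size a + i.+1).-1 + ((size b).-1).+1).-1 = (k.+1 + size (rev_poly b)).-1)%N.
  have := congr1 (fun p : {poly K} => size p) E.
  by rewrite !size_mul ?mulf_neq0 ?rev_poly_neq0 ?expf_neq0 ?polyX_eq0 // !size_polyXn.
have srb : (size (rev_poly b) <= size b)%N by apply: size_poly.
have sa : (0 < size a)%N by rewrite size_poly_gt0.
have sb : (0 < size b)%N by rewrite size_poly_gt0.
lia.
Qed.

End PlanarCurve.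

(** * Charts of a smooth plane curve *)

Lemma mpoly_ringind (n : nat) (R : comNzRingType) (P : {mpoly R[n]} -> Prop) :
  (forall c, P c%:MP) -> (forall i, P 'X_i) ->
  (forall p q, P p -> P q -> P (p + q)) -> (forall p q, P p -> P q -> P (p * q)) ->
  forall p, P p.
Proof.
move=> PC PX PD PM; have P1 : P 1 by rewrite -mpolyC1.
elim/mpolyind => [|c m p _ _ Pp]; first by rewrite -mpolyC0.
apply: PD Pp; rewrite -mul_mpolyC; apply: (PM) => //; rewrite mpolyXE_id.
apply: (big_ind P) => // i _; elim: (m i) => [|k IHk]; first by rewrite expr0.
by rewrite exprS; apply: PM.
Qed.

(** The chain rule, stated for a derivation [D] so as to serve both for the partial derivatives of a
    chart and for [dird] of a substitution. *)
Lemma mmap_derivation (n : nat) (R S : comNzRingType) (f : {rmorphism R -> S})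
    (h : 'I_n -> S) (D : S -> S) :
  {morph D : x y / x + y} -> (forall x y, D (x * y) = D x * y + x * D y) ->
  (forall c, D (f c) = 0) ->
  forall p, D (mmap f h p) = \sum_i mmap f h p^`M(i) * D (h i).
Proof.
move=> DD DM DC; elim/mpoly_ringind => [c|j|p q IHp IHq|p q IHp IHq].
- rewrite mmapC DC big1 // => i _.
  by rewrite mderivC raddf0 mul0r.
- rewrite mmapX mmap1U (bigD1 j) //= mderivX mnm1E eqxx scale1r -{1}[U_(j)%MM]add0m addmK.
  rewrite [X in _ + X]big1 => [|i ij]; last first.
    by rewrite mderivX mnm1E eq_sym (negPf ij) scale0r raddf0 mul0r.
  by rewrite addr0 mpolyX0 rmorph1 mul1r.
- rewrite raddfD DD IHp IHq -big_split; apply: eq_bigr => i _ /=.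
  by rewrite mderivD raddfD mulrDl.
- rewrite rmorphM DM IHp IHq mulr_suml mulr_sumr -big_split; apply: eq_bigr => i _ /=.
  have -> : (p * q)^`M(i) = p^`M(i) * q + p * q^`M(i) by exact: mderivM.
  by rewrite raddfD /= !rmorphM /=; ring.
Qed.

Lemma mmap_rmorph (n : nat) (R S T : comNzRingType) (f : {rmorphism R -> S})
    (h : 'I_n -> S) (g : {rmorphism S -> T}) (f' : {rmorphism R -> T}) (h' : 'I_n -> T) :
  (forall c, g (f c) = f' c) -> (forall i, g (h i) = h' i) ->
  forall p, g (mmap f h p) = mmap f' h' p.
Proof.
move=> gf gh; elim/mpoly_ringind => [c|j|p q IHp IHq|p q IHp IHq].
- by rewrite !mmapC gf.
- by rewrite !mmapX !mmap1U gh.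
- by rewrite !raddfD /= IHp IHq.
- by rewrite !rmorphM /= IHp IHq.
Qed.

(** * Homogeneous forms and directional derivatives *)

Section Homogeneous.
Variables (n : nat) (K : fieldType).
Implicit Types (h : {mpoly K[n]}) (v : 'rV[K]_n).

Lemma dhomog_scale e h c v : h \is e.-homog ->
  h.@[(c *: v) ord0] = c ^+ e * h.@[v ord0].
Proof.
move=> /dhomogP hh; rewrite !mevalE mulr_sumr; apply: eq_big_seq => m /hh /= <-.
rewrite mulrCA; congr (_ * _); rewrite mdegE -prodrXr -big_split /=.
by apply: eq_bigr => i _; rewrite mxE exprMn.
Qed.

Lemma dhomog_deriv e h i : h \is e.-homog -> h^`M(i) \is e.-1.-homog.
Proof.
move=> /dhomogP hh; apply/dhomogP => m; rewrite mcoeff_msupp mcoeff_mderiv => nz.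
have : (m + U_(i))%MM \in msupp h.
  by rewrite mcoeff_msupp; apply: contraNneq nz => ->; rewrite mul0rn.
by move/hh => /= <-; rewrite mdegD mdeg1 addn1.
Qed.

Lemma dhomog_euler e h : h \is e.-homog ->
  \sum_i 'X_i * h^`M(i) = e%:R *: h.
Proof.
move=> /dhomogP hh; rewrite [h in LHS]mpolyE [h in RHS]mpolyE scaler_sumr.
rewrite (eq_bigr (fun i => \sum_(m <- msupp h) 'X_i * (h@_m *: 'X_[m])^`M(i))); last first.
  by move=> i _; rewrite raddf_sum mulr_sumr.
rewrite exchange_big; apply: eq_big_seq => m /hh /= <-.
rewrite mdegE natr_sum scaler_suml; apply: eq_bigr => i _.
rewrite mderivZ mderivX -!scalerAr !scalerA mulrC -mpolyXD.
have [->|mi] := eqVneq (m i) 0%N; first by rewrite !mul0r !scale0r.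
by rewrite addmC submK // lep1mP ?mnm1E.
Qed.

Definition dird (w : 'rV[K]_n) h := \sum_i w ord0 i *: h^`M(i).

Lemma meval_dird w h v :
  (dird w h).@[v ord0] = \sum_i w ord0 i * (h^`M(i)).@[v ord0].
Proof. by rewrite /dird raddf_sum; apply: eq_bigr => i _; rewrite /= mevalZ. Qed.

Lemma dird_euler e h v : h \is e.-homog ->
  (dird v h).@[v ord0] = e%:R * h.@[v ord0].
Proof.
move=> hh; rewrite meval_dird -mevalZ -(dhomog_euler hh) raddf_sum.
by apply: eq_bigr => i _; rewrite /= mevalM mevalXU.
Qed.

Lemma meval_dirdD a b w w' h v : (dird (a *: w + b *: w') h).@[v ord0] =
  a * (dird w h).@[v ord0] + b * (dird w' h).@[v ord0].
Proof.
rewrite !meval_dird !mulr_sumr -big_split; apply: eq_bigr => i _ /=.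
by rewrite !mxE; ring.
Qed.

End Homogeneous.

Lemma coefM_top (S : nzRingType) (g h : {poly S}) k l :
  (size g <= k.+1)%N -> (size h <= l.+1)%N ->
  (g * h)`_(k + l) = g`_k * h`_l.
Proof.
move=> sg sh; rewrite coefM.
have kl : (k < (k + l).+1)%N by rewrite ltnS leq_addr.
rewrite (bigD1 (Ordinal kl)) //= addKn [X in _ + X]big1 ?addr0 // => i ik.
have [lki|lik] := ltnP k i; first by rewrite (nth_default _ (leq_trans sg lki)) mul0r.
rewrite [X in _ * X]nth_default ?mulr0 // (leq_trans sh) //.
have : (i : nat) != k by apply: contra ik => /eqP ik; apply/eqP/val_inj.
lia.
Qed.

Section Chart.
Variable K : closedFieldType.
Implicit Types (h : {mpoly K[3]}) (p q v w : 'rV[K]_3).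

(** The restriction of [h] to the points [x p + t q + q'], as a polynomial in [x] over [K[t]]; the
    projection from [p] is [(x, t) -> t]. *)
Definition chart p q q' h : {poly {poly K}} :=
  mmap (polyC \o polyC)
    (fun i => (p ord0 i)%:P%:P * 'X + (q ord0 i *: 'X + (q' ord0 i)%:P)%:P) h.

Lemma horner_chart p q q' h x t :
  (chart p q q' h).[x%:P].[t] = h.@[(x *: p + t *: q + q') ord0].
Proof.
apply: (mmap_rmorph (g := horner_eval t \o horner_eval x%:P) (f' := idfun)) => [c|i] /=.
  by rewrite /horner_eval !hornerC.
rewrite /horner_eval !mxE !(hornerMXaddC, hornerM, hornerD, hornerC, hornerX, hornerZ).
ring.
Qed.

Lemma deriv_chart p q q' h x t :
  (chart p q q' h)^`().[x%:P].[t] = (dird p h).@[(x *: p + t *: q + q') ord0].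
Proof.
rewrite /chart (@mmap_derivation _ _ _ (polyC \o polyC) _ (@deriv _)) => [|g1 g2|g1 g2|c].
- rewrite meval_dird !horner_sum; apply: eq_bigr => i _.
  rewrite !hornerM horner_chart mulrC; congr (_ * _).
  by rewrite derivD derivC addr0 derivM derivC derivX mul0r add0r mulr1 !hornerC.
- exact: derivD.
- exact: derivM.
- exact: derivC.
Qed.

Lemma deriv_chart2 p q q' h x t :
  ((chart p q q' h).[x%:P])^`().[t] = (dird q h).@[(x *: p + t *: q + q') ord0].
Proof.
pose l i : {poly K} := (p ord0 i * x + q' ord0 i)%:P + (q ord0 i)%:P * 'X.
have E g : (chart p q q' g).[x%:P] = mmap (@polyC K) l g.
  apply: (mmap_rmorph (g := horner_eval x%:P)) => [c|i] /=.
    by rewrite /horner_eval !hornerC.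
  rewrite /horner_eval /l !(hornerMXaddC, hornerM, hornerD, hornerC, hornerX).
  by rewrite -mul_polyC polyCD polyCM; ring.
rewrite E (@mmap_derivation _ _ _ (@polyC K) _ (@deriv _)) => [|g1 g2|g1 g2|c].
- rewrite meval_dird horner_sum; apply: eq_bigr => i _.
  rewrite hornerM -E horner_chart mulrC; congr (_ * _).
  by rewrite derivD derivC add0r derivM derivC derivX mul0r add0r mulr1 !hornerC.
- exact: derivD.
- exact: derivM.
- exact: derivC.
Qed.

(** Only [p] carries the variable [x], so the coefficient of [x ^ e] is a constant. For [F(p) = 1]
    it makes the chart of [F] monic: this is how a center outside the curve enters. *)
Lemma chart_top p q q' e h : h \is e.-homog ->
  (size (chart p q q' h) <= e.+1)%N /\ (chart p q q' h)`_e = (h.@[p ord0])%:P.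
Proof.
move=> /dhomogP hh.
pose T k (g : {poly {poly K}}) c := (size g <= k.+1)%N /\ g`_k = c%:P.
have TM k l g1 g2 c1 c2 : T k g1 c1 -> T l g2 c2 -> T (k + l)%N (g1 * g2) (c1 * c2).
  move=> [s1 e1] [s2 e2]; split; last by rewrite coefM_top // e1 e2 polyCM.
  by apply: (leq_trans (size_polyMleq _ _)); lia.
have TX k g c n : T k g c -> T (n * k)%N (g ^+ n) (c ^+ n).
  move=> Tg; elim: n => [|n IHn]; last by rewrite !exprS mulSn; apply: TM.
  by split; rewrite !expr0 ?mul0n ?size_poly1 // coefC.
pose l i := (p ord0 i)%:P%:P * 'X + (q ord0 i *: 'X + (q' ord0 i)%:P)%:P.
have Tl i : T 1%N (l i) (p ord0 i).
  split; last by rewrite coefD coefMX !coefC addr0.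
  by rewrite size_MXaddC; case: ifP => // _; rewrite ltnS size_polyC leq_b1.
have Tm m : T (mdeg m) (mmap1 l m) (\prod_i p ord0 i ^+ m i).
  rewrite mdegE /mmap1; elim/big_ind3: _ => [|k1 g1 c1 k2 g2 c2 t1 t2|i _].
  - by split; rewrite ?size_poly1 // coefC.
  - exact: TM.
  - by have := TX _ _ _ (m i) (Tl i); rewrite muln1.
rewrite mevalE /chart /mmap raddf_sum coef_sum; split.
  rewrite big_seq; apply: (big_ind (fun g : {poly {poly K}} => (size g <= e.+1)%N)).
  - by rewrite size_poly0.
  - by move=> g1 g2 s1 s2; rewrite (leq_trans (size_polyD _ _)) // geq_max s1.
  - move=> m /hh /= <-; rewrite mul_polyC; apply: leq_trans (size_scale_leq _ _) _.
    exact: (Tm m).1.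
apply: eq_big_seq => m /hh /= <-.
by rewrite coefCM (Tm m).2 polyCM.
Qed.

End Chart.

Definition lform (K : fieldType) (n : nat) (l : 'cV[K]_n) : {mpoly K[n]} :=
  \sum_i l i ord0 *: 'X_i.

Lemma meval_lform (K : fieldType) n (l : 'cV[K]_n) (v : 'rV[K]_n) :
  (lform l).@[v ord0] = (v *m l) ord0 ord0.
Proof.
rewrite /lform raddf_sum mxE; apply: eq_bigr => i _.
by rewrite /= mevalZ mevalXU mulrC.
Qed.

Lemma dhomog_lform (K : fieldType) n (l : 'cV[K]_n) : lform l \is 1.-homog.
Proof. by apply: rpred_sum => i _; apply: rpredZ; rewrite dhomogX /= mdeg1. Qed.

(* [p] is the center of the homology, and [l = 0] its axis. *)
Definition homology (K : fieldType) (F : {mpoly K[3]}) (N : nat) (p : 'rV[K]_3) :=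
  exists zeta (l : 'cV[K]_3), [/\ N.-primitive_root zeta, (p *m l) ord0 ord0 = 1 &
    forall v : 'rV[K]_3,
      F.@[(v + ((zeta - 1) * (v *m l) ord0 ord0) *: p) ord0] = F.@[v ord0]].

Section Curve.
Variable K : closedFieldType.
Hypothesis charK0 : [pchar K] =i pred0.
Variables (d : nat) (F : {mpoly K[3]}).
Hypothesis d_gt1 : (1 < d)%N.
Hypothesis smF : smooth_plane_curve d F.
Implicit Types (h : {mpoly K[3]}) (v w : 'rV[K]_3).

Let homF : F \is d.-homog. Proof. by case: smF. Qed.

Lemma smooth_dird v : v != 0 -> F.@[v ord0] = 0 ->
  ~ (forall w, (dird w F).@[v ord0] = 0).
Proof.
move=> v0 Fv dF; have [_ _ /(_ v v0 Fv)[i /eqP[]]] := smF.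
rewrite -(dF (delta_mx 0 i)) meval_dird (bigD1 i) //= mxE !eqxx mul1r big1 ?addr0 //.
by move=> j ji; rewrite mxE eqxx (negPf ji) mul0r.
Qed.

Section Charts.
Variable p : 'rV[K]_3.
Hypothesis Fp : F.@[p ord0] = 1.

Section OneChart.
Variables q q' : 'rV[K]_3.
Hypothesis span : forall v, exists a b c, v = a *: p + b *: q + c *: q'.
Hypothesis chart_neq0 : forall x t, x *: p + t *: q + q' != 0.

(** The derivatives of [F] along [p] and [q] are the partial derivatives of the chart, and along the
    point itself the derivative is [d * F = 0] by Euler. These three vectors span, so a singular
    point of the chart would be one of [F]. *)
Lemma chart_smooth : affine_smooth (chart p q q' F).
Proof.
move=> x t; rewrite deriv_chart deriv_chart2 horner_chart => Fv.
set v := x *: p + t *: q + q' in Fv *.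
have [dp|] := eqVneq (dird p F).@[v ord0] 0; last by left.
have [dq|] := eqVneq (dird q F).@[v ord0] 0; last by right.
case: (smooth_dird (chart_neq0 x t) Fv) => w.
have [a [b [c ->]]] := span w.
have -> : a *: p + b *: q + c *: q' =
    1 *: ((a - c * x) *: p + (b - c * t) *: q) + c *: v.
  by apply/rowP=> i; rewrite !mxE; ring.
rewrite meval_dirdD (dird_euler _ homF) Fv meval_dirdD dp dq.
by rewrite !(mulr0, addr0).
Qed.

Lemma size_chart : size (chart p q q' F) = d.+1.
Proof.
have [sF Fd] := chart_top p q q' homF.
apply/eqP; rewrite eqn_leq sF ltnNge; apply: contraPN Fd => /leq_sizeP/(_ d (leqnn d)) ->.
by rewrite Fp => /esym/eqP; rewrite polyC_eq0 oner_eq0.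
Qed.

Lemma chart_monic : chart p q q' F \is monic.
Proof.
by rewrite monicE lead_coefE size_chart /= (chart_top p q q' homF).2 Fp.
Qed.

Definition generic_on_curve (P : 'rV[K]_3 -> Prop) := generic (fun t =>
  forall x, F.@[(x *: p + t *: q + q') ord0] = 0 -> P (x *: p + t *: q + q')).

Lemma generic_on_curve_mono (P Q : 'rV[K]_3 -> Prop) :
  (forall v, v != 0 -> F.@[v ord0] = 0 -> P v -> Q v) -> generic_on_curve P -> generic_on_curve Q.
Proof.
move=> PQ; apply: generic_mono => t Pt x Fx.
by apply: PQ (Pt x Fx).
Qed.

Lemma generic_on_curve_and (P Q : 'rV[K]_3 -> Prop) : generic_on_curve P -> generic_on_curve Q ->
  generic_on_curve (fun v => P v /\ Q v).
Proof.
move=> gP gQ; apply: generic_mono (generic_and gP gQ) => t [Pt Qt] x Fx.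
by split; [apply: Pt|apply: Qt].
Qed.

Lemma generic_on_curve_vanish h : generic_on_curve (fun v => h.@[v ord0] = 0) ->
  forall x t, F.@[(x *: p + t *: q + q') ord0] = 0 -> h.@[(x *: p + t *: q + q') ord0] = 0.
Proof.
move=> gh x t Fx; rewrite -horner_chart.
apply: (vanish_generic charK0 chart_monic chart_smooth); last by rewrite /on_f horner_chart.
apply: generic_mono gh => {Fx}t ht {}x; rewrite /on_f !horner_chart; exact: ht.
Qed.

(** The quotient [g * g' / D] from von Neumann regularity is 1 or 0 according as [g] is nonzero or
    zero. It is a root of [X * (X - 1)], hence integral. *)
Lemma chart_idempotent g : exists W : {poly {poly K}}, generic (fun t => forall x, on_f (chart p q q' F) x t ->
    W.[x%:P].[t] = (g.@[(x *: p + t *: q + q') ord0] != 0)%:R).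
Proof.
set f := chart p q q' F.
have [g' [D [D0 E]]] := von_neumann_regular charK0 chart_monic chart_smooth (chart p q q' g).
pose Q : {poly {poly K}} := 'X * ('X - 1%:P).
have Qm : Q \is monic by rewrite monicMl ?monicX ?monicXsubC.
have [|W EW] := @integral_dvd K charK0 f chart_monic chart_smooth (chart p q q' g * g') D Q Qm D0.
  apply: generic_mono (generic_poly D0) => t Dt x fx.
  rewrite specM specB specC hornerC /spec map_polyX !(hornerM, hornerD, hornerN, hornerX, hornerC).
  set z := (chart p q q' g).[_].[_]; have := E x t fx; rewrite -/z.
  move/eqP; rewrite mulf_eq0 => /orP[/eqP->|]; first by rewrite !mul0r.
  by rewrite subr_eq0 => /eqP ->; rewrite divff // subrr mulr0.
exists W.
apply: generic_mono (generic_poly D0) => t Dt x fx; apply: (mulfI Dt).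
rewrite -EW // hornerM hornerM; have := E x t fx; rewrite horner_chart.
set z := meval _ _; have [->|z0] := eqVneq z 0; first by rewrite !(mul0r, mulr0).
move/eqP; rewrite mulf_eq0 (negPf z0) subr_eq0 => /eqP ->.
by rewrite mulr1.
Qed.

(** Where [g] is nonzero, [g' / D] is its inverse, so [h / g] acquires a denominator in [t] alone
    and [integral_dvd] applies. *)
Lemma chart_quotient h g Q : Q \is monic -> generic_on_curve (fun v => g.@[v ord0] != 0) ->
  generic (fun t => forall x, on_f (chart p q q' F) x t ->
    (spec t Q).[h.@[(x *: p + t *: q + q') ord0] / g.@[(x *: p + t *: q + q') ord0]] = 0) ->
  exists W : {poly {poly K}}, generic (fun t => forall x, on_f (chart p q q' F) x t ->
    W.[x%:P].[t] = h.@[(x *: p + t *: q + q') ord0] / g.@[(x *: p + t *: q + q') ord0]).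
Proof.
move=> Qm gg int; set f := chart p q q' F.
have [g' [D [D0 E]]] := von_neumann_regular charK0 chart_monic chart_smooth (chart p q q' g).
have E' t : D.[t] != 0 -> (forall x, F.@[(x *: p + t *: q + q') ord0] = 0 ->
        g.@[(x *: p + t *: q + q') ord0] != 0) -> forall x, on_f f x t ->
    h.@[(x *: p + t *: q + q') ord0] / g.@[(x *: p + t *: q + q') ord0] =
    (chart p q q' h * g').[x%:P].[t] / D.[t].
  move=> Dt gt x fx; have := E x t fx; rewrite horner_chart => /eqP; rewrite mulf_eq0.
  have g0 : g.@[(x *: p + t *: q + q') ord0] != 0 by apply: gt; rewrite -horner_chart.
  rewrite (negPf g0) subr_eq0 => /eqP <-; rewrite !hornerM horner_chart.
  rewrite invfM mulrACA divff ?mulr1 //.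
  by apply: contraNneq Dt => g'0; move/eqP: (E x t fx); rewrite horner_chart g'0 mulr0 mulf_eq0 (negPf g0) sub0r oppr_eq0.
have [|W EW] := @integral_dvd K charK0 f chart_monic chart_smooth (chart p q q' h * g') D Q Qm D0.
  apply: generic_mono (generic_and (generic_and int gg) (generic_poly D0)) => t [[it gt] Dt] x fx.
  by rewrite -E' // it.
exists W; apply: generic_mono (generic_and gg (generic_poly D0)) => t [gt Dt] x fx.
by rewrite E' // EW // mulrC mulKf.
Qed.

End OneChart.

(** * Gluing the two charts of the projection from [p] *)

Variables q1 q2 : 'rV[K]_3.
Variables cx cy cz : 'rV[K]_3 -> K.
Hypothesis dec : forall v, v = cx v *: p + cy v *: q1 + cz v *: q2.
Hypothesis cxE : forall x y z, cx (x *: p + y *: q1 + z *: q2) = x.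
Hypothesis cyE : forall x y z, cy (x *: p + y *: q1 + z *: q2) = y.
Hypothesis czE : forall x y z, cz (x *: p + y *: q1 + z *: q2) = z.

Local Notation pt x y z := (x *: p + y *: q1 + z *: q2).

Lemma pt_eq0 x y z : pt x y z = 0 -> [/\ x = 0, y = 0 & z = 0].
Proof.
have E0 : pt 0 0 0 = 0 by rewrite !scale0r !addr0.
have := (cxE 0 0 0, cyE 0 0 0, czE 0 0 0); rewrite E0 => -[[cx0 cy0] cz0] E.
split; first by rewrite -(cxE x y z) E.
  by rewrite -(cyE x y z) E.
by rewrite -(czE x y z) E.
Qed.

Let span12 v : exists a b c, v = a *: p + b *: q1 + c *: q2.
Proof. by exists (cx v), (cy v), (cz v). Qed.

Let span21 v : exists a b c, v = a *: p + b *: q2 + c *: q1.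
Proof. by exists (cx v), (cz v), (cy v); rewrite addrAC. Qed.

Let neq12 x t : x *: p + t *: q1 + q2 != 0.
Proof.
apply/eqP => E; have [|_ _ /eqP] := @pt_eq0 x t 1; first by rewrite scale1r.
by rewrite oner_eq0.
Qed.

Let neq21 x t : x *: p + t *: q2 + q1 != 0.
Proof.
apply/eqP => E; have [|_ /eqP] := @pt_eq0 x 1 t; first by rewrite scale1r addrAC.
by rewrite oner_eq0.
Qed.

Lemma chart_swap x t : t != 0 ->
  x *: p + t *: q1 + q2 = t *: ((x / t) *: p + t^-1 *: q2 + q1).
Proof.
move=> t0; rewrite !scalerDr !scalerA mulrCA divff // mulr1 scale1r addrAC.
by [].
Qed.

Lemma chart_swap_F x t : t != 0 -> F.@[(x *: p + t *: q1 + q2) ord0] = 0 ->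
  F.@[((x / t) *: p + t^-1 *: q2 + q1) ord0] = 0.
Proof.
move=> t0; rewrite chart_swap // (dhomog_scale _ _ homF) => /eqP.
by rewrite mulf_eq0 expf_eq0 (negPf t0) andbF => /eqP.
Qed.

Lemma generic_on_curve_swap (P : 'rV[K]_3 -> Prop) : (forall c v, c != 0 -> P v -> P (c *: v)) ->
  generic_on_curve q1 q2 P -> generic_on_curve q2 q1 P.
Proof.
move=> Ps /generic_inv/(generic_and (generic_neq0 K)).
apply: generic_mono => t [t0 Pt] x Fx.
have E : x *: p + t *: q2 + q1 = t *: ((x / t) *: p + t^-1 *: q1 + q2).
  by rewrite !scalerDr !scalerA mulrCA !divff // mulr1 scale1r addrAC.
rewrite E; apply: Ps => //; apply: Pt; move: Fx; rewrite E (dhomog_scale _ _ homF) => /eqP.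
by rewrite mulf_eq0 expf_eq0 (negPf t0) andbF => /eqP.
Qed.

(** The two charts cover all points but [p], which is not on the curve because [F] is 1 there. *)
Lemma generic_on_curve_vanishes_on e h : h \is e.-homog -> generic_on_curve q1 q2 (fun v => h.@[v ord0] = 0) ->
  vanishes_on F h.
Proof.
move=> hh gh v v0 Fv.
have gh' : generic_on_curve q2 q1 (fun v => h.@[v ord0] = 0).
  by apply: generic_on_curve_swap gh => c w c0 hw; rewrite (dhomog_scale _ _ hh) hw mulr0.
have [z0|z0] := eqVneq (cz v) 0; last first.
  have [c [x [t [c0 E]]]] : exists c x t, c != 0 /\ v = c *: (x *: p + t *: q1 + q2).
    exists (cz v), (cx v / cz v), (cy v / cz v); split=> //.
    by rewrite !scalerDr !scalerA !(mulrC (cz v)) !divfK // -dec.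
  rewrite E (dhomog_scale _ _ hh) (generic_on_curve_vanish span12 neq12 gh) ?mulr0 //.
  move: Fv; rewrite E (dhomog_scale _ _ homF) => /eqP.
  by rewrite mulf_eq0 expf_eq0 (negPf c0) andbF => /eqP.
have [y0|y0] := eqVneq (cy v) 0; last first.
  have [c [x [t [c0 E]]]] : exists c x t, c != 0 /\ v = c *: (x *: p + t *: q2 + q1).
    exists (cy v), (cx v / cy v), (cz v / cy v); split=> //.
    by rewrite !scalerDr !scalerA !(mulrC (cy v)) !divfK // addrAC -dec.
  rewrite E (dhomog_scale _ _ hh) (generic_on_curve_vanish span21 neq21 gh') ?mulr0 //.
  move: Fv; rewrite E (dhomog_scale _ _ homF) => /eqP.
  by rewrite mulf_eq0 expf_eq0 (negPf c0) andbF => /eqP.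
move: v0 Fv; rewrite (dec v) y0 z0 !scale0r !addr0 => v0.
rewrite (dhomog_scale _ _ homF) Fp mulr1 => /eqP; rewrite expf_eq0 => /andP[_ /eqP x0].
by move: v0; rewrite x0 scale0r eqxx.
Qed.

Let f1 := chart p q1 q2 F.
Let f2 := chart p q2 q1 F.
Let m1 : f1 \is monic := chart_monic q1 q2.
Let m2 : f2 \is monic := chart_monic q2 q1.
Let s1 : affine_smooth f1 := chart_smooth span12 neq12.
Let s2 : affine_smooth f2 := chart_smooth span21 neq21.
Let f12 x t : t != 0 -> on_f f1 x t -> on_f f2 (x / t) t^-1.
Proof. by move=> t0; rewrite /on_f !horner_chart; apply: chart_swap_F. Qed.

Lemma chart_eval0 (h : {poly {poly K}}) :
  generic (fun t => forall x, on_f f1 x t -> h.[x%:P].[t] = 0) -> 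
  (size h <= d)%N -> h = 0.
Proof.
move=> /(vanish_dvd charK0 m1 s1)[w E] sh; apply/eqP; apply: contraTT sh => h0.
have w0 : w != 0 by apply: contraNneq h0 => w0; rewrite E w0 mul0r.
rewrite -ltnNge E size_Mmonic // size_chart.
by have := size_poly_gt0 w; rewrite w0; lia.
Qed.

(* A plane curve without singular points is irreducible: the idempotent
   supported where [g] does not vanish extends to both charts, hence is a
   constant. *)
Lemma homog_dichotomy e g : g \is e.-homog ->
  vanishes_on F g \/ generic_on_curve q1 q2 (fun v => g.@[v ord0] != 0).
Proof.
move=> hg.
have [W1 E1] := chart_idempotent span12 neq12 g.
have [W2 E2] := chart_idempotent span21 neq21 g.
have [||W [EW sW]] := @two_charts K charK0 f1 f2 0 W1 W2 m1 s1 m2 _ f12.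
- by rewrite !size_chart.
- apply: generic_mono (generic_and (generic_and E1 (generic_inv E2)) (generic_neq0 K)).
  move=> t [[e1 e2] t0] x fx; rewrite expr0 mul1r e1 // (e2 _ (f12 t0 fx)) chart_swap //.
  by rewrite (dhomog_scale _ _ hg) mulf_eq0 expf_eq0 (negPf t0) andbF.
(* For [k = 0] the degree bounds of [two_charts] leave a constant only. *)
have WC : exists c, W = c%:P%:P.
  have -> : W = (W`_0)%:P.
    apply/polyP => -[|i]; rewrite coefC //=; apply/eqP.
    by rewrite -size_poly_eq0 -leqn0 (leq_trans (sW _)).
  have := sW 0%N; rewrite subn0 => /size1_polyC ->; by eexists.
move: WC => [c WE].
have gc : generic_on_curve q1 q2 (fun v => c = (g.@[v ord0] != 0)%:R).
  apply: generic_mono E1 => t e1 x Fx; rewrite -e1 /on_f ?horner_chart //.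
  by rewrite EW /on_f ?horner_chart // WE !hornerC.
have [c0|c0] := eqVneq c 0; [left|right].
  apply: (generic_on_curve_vanishes_on hg); apply: generic_on_curve_mono gc => // v _ _; rewrite c0.
  by case: eqVneq => // _ /esym/eqP; rewrite oner_eq0.
apply: generic_on_curve_mono gc => // v _ _; case: eqVneq => // _ /eqP.
by rewrite (negPf c0).
Qed.

Lemma coord_scale c v : [/\ cx (c *: v) = c * cx v, cy (c *: v) = c * cy v
  & cz (c *: v) = c * cz v].
Proof.
have E : c *: v = pt (c * cx v) (c * cy v) (c * cz v).
  by rewrite {1}(dec v) !scalerDr !scalerA.
by split; rewrite E ?cxE ?cyE ?czE.
Qed.

Let coord1 x t : (cx (x *: p + t *: q1 + q2), cy (x *: p + t *: q1 + q2),
  cz (x *: p + t *: q1 + q2)) = (x, t, 1).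
Proof. by rewrite -[q2]scale1r cxE cyE czE. Qed.

Let coord2 x t : (cx (x *: p + t *: q2 + q1), cy (x *: p + t *: q2 + q1),
  cz (x *: p + t *: q2 + q1)) = (x, 1, t).
Proof. by rewrite addrAC -[q1]scale1r cxE cyE czE. Qed.

Lemma size1_horner (c : {poly K}) t : (size c <= 1)%N -> c.[t] = c`_0.
Proof. by move=> /size1_polyC ->; rewrite hornerC coefC. Qed.

(* In each chart [h0 / h2] is integral over the ring of functions of [t], hence
   regular. Comparing the two charts bounds its degree by one. *)
Lemma linearize e h0 h1 h2 :
  h0 \is e.-homog -> h1 \is e.-homog -> h2 \is e.-homog ->
  generic_on_curve q1 q2 (fun v => h2.@[v ord0] != 0) ->
  generic_on_curve q1 q2 (fun v => h1.@[v ord0] * cz v = h2.@[v ord0] * cy v) ->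
  generic_on_curve q1 q2 (fun v => F.@[(pt h0.@[v ord0] h1.@[v ord0] h2.@[v ord0]) ord0] = 0) ->
  exists a b c, generic_on_curve q1 q2 (fun v =>
    h0.@[v ord0] * cz v = h2.@[v ord0] * (a * cx v + b * cy v + c * cz v)).
Proof.
move=> hh0 hh1 hh2 g2 g12 gF.
have G := generic_on_curve_and g2 (generic_on_curve_and g12 gF).
(* The integral equation is [f1] itself: the image point lies on the curve and on the same line
   through [p], so [h0 / h2] is the coordinate [x] of a point of the same fibre. *)
have [|W1 E1] := chart_quotient span12 neq12 (h := h0) m1 g2.
  apply: generic_mono G => t Gt x; rewrite /on_f !horner_chart => Fx.
  have [z2 [z12 zF]] := Gt x Fx; rewrite horner_spec horner_chart.
  case: (coord1 x t) z12 => _ -> ->; rewrite mulr1 => z12; rewrite z12 in zF.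
  set v := x *: p + _ + _ in z2 z12 zF *.
  have : F.@[(h2.@[v ord0] *: (h0.@[v ord0] / h2.@[v ord0] *: p + t *: q1 + q2)) ord0] = 0.
    by rewrite !scalerDr !scalerA mulrC divfK.
  rewrite (dhomog_scale _ _ homF) => /eqP.
  by rewrite mulf_eq0 expf_eq0 (negPf z2) andbF => /eqP.
have G' : generic_on_curve q2 q1 (fun v => h2.@[v ord0] != 0 /\
    (h1.@[v ord0] * cz v = h2.@[v ord0] * cy v /\
     F.@[(pt h0.@[v ord0] h1.@[v ord0] h2.@[v ord0]) ord0] = 0)).
  apply: generic_on_curve_swap G => c v c0 [z2 [z12 zF]]; have [_ -> ->] := coord_scale c v.
  rewrite (dhomog_scale _ _ hh0) (dhomog_scale _ _ hh1) (dhomog_scale _ _ hh2).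
  rewrite mulf_neq0 ?expf_neq0 //; split=> //; split.
    by rewrite mulrACA z12 mulrACA.
  by rewrite -!scalerA -!scalerDr (dhomog_scale _ _ homF) zF mulr0.
(* In the second chart [cy] is 1, and [h1] takes over as denominator; it is nonzero because
   [h1 * t = h2]. *)
have G2 : generic_on_curve q2 q1 (fun v => h1.@[v ord0] != 0).
  apply: generic_mono G' => t Gt x Fx; have [z2 [z12 _]] := Gt x Fx.
  case: (coord2 x t) z12 => _ -> ->; rewrite mulr1 => z12.
  by apply: contraNneq z2 => z1; rewrite -z12 z1 mul0r.
have [|W2 E2] := chart_quotient span21 neq21 (h := h0) m2 G2.
  apply: generic_mono (generic_and G' G2) => t [Gt Gt2] x; rewrite /on_f !horner_chart => Fx.
  have [z2 [z12 zF]] := Gt x Fx; rewrite horner_spec horner_chart.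
  have z1 := Gt2 x Fx.
  case: (coord2 x t) z12 => _ -> ->; rewrite mulr1 => z12; rewrite -z12 in zF.
  set v := x *: p + _ + _ in z1 z2 z12 zF *.
  have : F.@[(h1.@[v ord0] *: (h0.@[v ord0] / h1.@[v ord0] *: p + t *: q2 + q1)) ord0] = 0.
    by rewrite !scalerDr !scalerA mulrC divfK // addrAC.
  rewrite (dhomog_scale _ _ homF) => /eqP.
  by rewrite mulf_eq0 expf_eq0 (negPf z1) andbF => /eqP.
have [||W [EW sW]] := @two_charts K charK0 f1 f2 1 W1 W2 m1 s1 m2 _ f12.
- by rewrite !size_chart.
- apply: generic_mono (generic_and (generic_and E1 (generic_inv E2))
    (generic_and (generic_neq0 K) (generic_inv G'))).
  move=> t [[e1 e2] [t0 g']] x fx; have fx2 := f12 t0 fx.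
  rewrite expr1 e1 // (e2 _ fx2) chart_swap //.
  move: fx2; rewrite /on_f horner_chart => fx2.
  have [z2 [z12 _]] := g' _ fx2.
  case: (coord2 (x / t) t^-1) z12 => _ -> ->; rewrite mulr1 => z12.
  rewrite (dhomog_scale _ _ hh0) (dhomog_scale _ _ hh2) -z12.
  set v := _ + q1 in z2 z12 *.
  have z1 : h1.@[v ord0] != 0 by apply: contraNneq z2 => z1; rewrite -z12 z1 mul0r.
  by field; rewrite ?z1 ?t0 ?expf_neq0.
(* For [k = 1] the bounds make the coefficient of [x] constant, that of [x ^ 0] of degree at most 1
   in [t], and the others zero: [W = a x + b t + c]. *)
exists (W`_1)`_0, (W`_0)`_1, (W`_0)`_0.
apply: generic_mono (generic_and E1 g2) => t [e1 gt] x Fx.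
have fx : on_f f1 x t by rewrite /on_f horner_chart.
have z2 := gt x Fx; move: (EW x t fx) (e1 x fx) => -> /(congr1 (fun z => z * h2.@[(x *: p + t *: q1 + q2) ord0])).
case: (coord1 x t) => -> -> ->; rewrite divfK // !mulr1 mulrC => <-; congr (_ * _).
have sW2 : (size W <= 2)%N.
  by apply/leq_sizeP => -[|[|j]] // _; apply/eqP; rewrite -size_poly_eq0 -leqn0 (leq_trans (sW _)).
rewrite (horner_coef_wide _ sW2) !big_ord_recl big_ord0 /= expr0 mulr1 addr0.
rewrite hornerD hornerM hornerC (size1_horner _ (sW 1%N)).
rewrite (horner_coef_wide _ (sW 0%N)) !big_ord_recl big_ord0 /= expr0 mulr1 addr0 expr1.
by rewrite /bump /= addrC addrA; ring.
Qed.

Lemma coord_linear a v w : [/\ cx (a *: v + w) = a * cx v + cx w,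
  cy (a *: v + w) = a * cy v + cy w & cz (a *: v + w) = a * cz v + cz w].
Proof.
have E : a *: v + w = pt (a * cx v + cx w) (a * cy v + cy w) (a * cz v + cz w).
  rewrite {1}(dec v) {1}(dec w); apply/rowP => i; rewrite !mxE; ring.
by split; rewrite E ?cxE ?cyE ?czE.
Qed.

(** * Linear maps compatible with the projection from [p] *)

Definition lin a b c v := pt (a * cx v + b * cy v + c * cz v) (cy v) (cz v).

Lemma lin_pt a b c x y z : lin a b c (pt x y z) = pt (a * x + b * y + c * z) y z.
Proof. by rewrite /lin cxE cyE czE. Qed.

Lemma linZ a b c k v : lin a b c (k *: v) = k *: lin a b c v.
Proof.
have [E1 E2 E3] := coord_scale k v; rewrite /lin E1 E2 E3.
by rewrite !scalerDr !scalerA; congr (_ *: _ + _ + _); ring.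
Qed.

(** The factor [a ^+ d] is dictated by [p], which the map multiplies by [a]. With it the terms in
    [x ^ d] cancel, and the difference of the two sides is a multiple of the monic chart of [F] of
    degree less than [d], hence zero. *)
Lemma lin_preserves a b c : generic_on_curve q1 q2 (fun v => F.@[(lin a b c v) ord0] = 0) ->
  forall v, F.@[(lin a b c v) ord0] = a ^+ d * F.@[v ord0].
Proof.
move=> gF.
have gF' : generic_on_curve q2 q1 (fun v => F.@[(lin a b c v) ord0] = 0).
  by apply: generic_on_curve_swap gF => k v k0; rewrite linZ (dhomog_scale _ _ homF) => ->; rewrite mulr0.
have H q q' k k' :
    (forall v, exists a b c, v = a *: p + b *: q + c *: q') ->
    (forall x t, x *: p + t *: q + q' != 0) ->
    (forall x t, lin a b c (x *: p + t *: q + q') =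
      x *: (a *: p) + t *: (k *: p + q) + (k' *: p + q')) ->
    generic_on_curve q q' (fun v => F.@[(lin a b c v) ord0] = 0) ->
    forall x t, F.@[(lin a b c (x *: p + t *: q + q')) ord0] =
      a ^+ d * F.@[(x *: p + t *: q + q') ord0].
  move=> sp nz El gq.
  pose G := chart (a *: p) (k *: p + q) (k' *: p + q') F - (a ^+ d)%:P%:P * chart p q q' F.
  have [sG1 G1] := chart_top (a *: p) (k *: p + q) (k' *: p + q') homF.
  have [sG2 G2] := chart_top p q q' homF.
  have sG : (size G <= d)%N.
    apply/leq_sizeP => j; rewrite leq_eqVlt => /orP[/eqP <-|dj].
      by rewrite coefB coefCM G1 G2 (dhomog_scale _ _ homF) Fp mulr1 mulr1 subrr.
    rewrite nth_default // (leq_trans (size_polyD _ _)) // geq_max size_polyN.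
    rewrite (leq_trans sG1) //= mul_polyC (leq_trans (size_scale_leq _ _)) //.
    exact: leq_trans sG2 _.
  have G0 : G = 0.
    have [g E] : exists g : {poly {poly K}}, G = g * chart p q q' F.
      apply: (vanish_dvd charK0 (chart_monic q q') (chart_smooth sp nz)).
      apply: generic_mono gq => t gt x; rewrite /on_f horner_chart => Fx.
      rewrite hornerD hornerN hornerM hornerC hornerD hornerN hornerM hornerC !horner_chart.
      by rewrite Fx mulr0 subr0 -El gt.
    apply/eqP; apply: contraTT sG => h0.
    have g0 : g != 0 by apply: contraNneq h0 => g0; rewrite E g0 mul0r.
    rewrite -ltnNge E size_Mmonic ?chart_monic // size_chart.
    by have := size_poly_gt0 g; rewrite g0; lia.
  move=> x t; rewrite El -!horner_chart; apply/eqP; rewrite -subr_eq0.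
  have := congr1 (fun g : {poly {poly K}} => g.[x%:P].[t]) G0.
  rewrite /G hornerD hornerN hornerM hornerC hornerD hornerN hornerM hornerC => ->.
  by rewrite !horner0.
have H1 := H q1 q2 b c span12 neq12 _ gF.
have H2 := H q2 q1 c b span21 neq21 _ gF'.
move=> v.
have [z0|z0] := eqVneq (cz v) 0; last first.
  have [k [x [t ->]]] : exists k x t, v = k *: (x *: p + t *: q1 + q2).
    exists (cz v), (cx v / cz v), (cy v / cz v).
    by rewrite !scalerDr !scalerA !(mulrC (cz v)) !divfK // -dec.
  rewrite linZ !(dhomog_scale _ _ homF) H1; first by rewrite mulrCA.
  move=> x' t'; rewrite -[q2]scale1r lin_pt.
  by apply/rowP => i; rewrite !mxE; ring.
have [y0|y0] := eqVneq (cy v) 0; last first.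
  have [k [x [t ->]]] : exists k x t, v = k *: (x *: p + t *: q2 + q1).
    exists (cy v), (cx v / cy v), (cz v / cy v).
    by rewrite !scalerDr !scalerA !(mulrC (cy v)) !divfK // addrAC -dec.
  rewrite linZ !(dhomog_scale _ _ homF) H2; first by rewrite mulrCA.
  move=> x' t'; rewrite addrAC -[q1]scale1r lin_pt.
  by apply/rowP => i; rewrite !mxE; ring.
rewrite (dec v) y0 z0 lin_pt !mulr0 !scale0r !addr0 -scalerA.
by rewrite (dhomog_scale _ _ homF).
Qed.

Lemma linear_form (phi : 'rV[K]_3 -> K) :
  (forall a v w, phi (a *: v + w) = a * phi v + phi w) ->
  exists l : 'cV[K]_3, forall v, (v *m l) ord0 ord0 = phi v.
Proof.
move=> Lphi.
have phi0 : phi 0 = 0.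
  by have := Lphi 1 0 0; rewrite scaler0 addr0 mul1r => /eqP; rewrite -subr_eq0 opprD addNKr oppr_eq0 => /eqP.
exists (\col_i phi (delta_mx 0 i)) => v; rewrite {2}(row_sum_delta v) mxE.
rewrite (big_morph phi (id1 := 0) (op1 := +%R)) //; last first.
  by move=> v1 v2; have := Lphi 1 v1 v2; rewrite scale1r mul1r.
apply: eq_bigr => i _; rewrite mxE -[_ *: _]addr0 Lphi phi0 addr0.
by [].
Qed.

(** The form [x - b y - c z] has degree 1 < d in [x] and cannot vanish on the whole curve. By
    [homog_dichotomy] it is nonzero at the curve points of a generic fibre, so the point of the line
    in that fibre is off the curve. *)
Lemma no_line b c : exists v, cx v = b * cy v + c * cz v /\ F.@[v ord0] != 0.
Proof.
pose phi v := cx v - (b * cy v + c * cz v).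
have [|l El] := linear_form (phi := phi).
  by move=> k v w; have [E1 E2 E3] := coord_linear k v w; rewrite /phi E1 E2 E3; ring.
have [|gl] := homog_dichotomy (dhomog_lform l).
  move=> lF; suff /eqP : 'X - (b *: 'X + c%:P)%:P = 0 :> {poly {poly K}}.
    by rewrite polyXsubC_eq0.
  apply: chart_eval0; last by rewrite size_XsubC.
  apply: generic_all => t x; rewrite /on_f horner_chart => Fx.
  have := lF _ (neq12 x t) Fx; rewrite meval_lform El /phi.
  case: (coord1 x t) => -> -> ->; rewrite mulr1 => <-.
  by rewrite hornerD hornerN hornerX hornerC !(hornerD, hornerN, hornerZ, hornerX, hornerC).
have [t gt] := generic_ex gl.
exists ((b * t + c) *: p + t *: q1 + q2).
case: (coord1 (b * t + c) t) => E1 E2 E3; split; first by rewrite E1 E2 E3 mulr1.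
apply/eqP => /gt/eqP[]; rewrite meval_lform El /phi E1 E2 E3.
by rewrite mulr1 subrr.
Qed.

(** For [a = 0] the map projects onto the line [x = b y + c z], on which [F] would vanish. *)
Lemma lin_neq0 a b c : (forall v, F.@[(lin a b c v) ord0] = a ^+ d * F.@[v ord0]) ->
  a != 0.
Proof.
move=> H; apply/eqP => a0; have [v [E /eqP[]]] := no_line b c.
have := H v; rewrite a0 expr0n (gtn_eqF (ltnW d_gt1)) mul0r => <-.
by rewrite /lin mul0r add0r -E -dec.
Qed.

(* Otherwise [F] would be invariant under a translation of the variable [x] on
   some line through [p], where it is not constant. *)
Lemma lin_determined a b c b' c' :
  (forall v, F.@[(lin a b c v) ord0] = a ^+ d * F.@[v ord0]) ->
  (forall v, F.@[(lin a b' c' v) ord0] = a ^+ d * F.@[v ord0]) ->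
  b = b' /\ c = c'.
Proof.
move=> H H'; have a0 := lin_neq0 H.
suff S y z : (b' - b) * y + (c' - c) * z = 0.
  have := S 1 0; have := S 0 1; rewrite !mulr0 !mulr1 addr0 add0r.
  by split; apply/esym/eqP; rewrite -subr_eq0; apply/eqP.
set m := _ + _; apply/eqP; apply: contraT => m0; set w := y *: q1 + z *: q2.
have per x : F.@[((x + m) *: p + w) ord0] = F.@[(x *: p + w) ord0].
  have E : x *: p + w = lin a b c (pt ((x - b * y - c * z) / a) y z).
    by rewrite lin_pt mulrC divfK // /w addrA; congr (_ *: _ + _ + _); ring.
  have -> : (x + m) *: p + w = lin a b' c' (pt ((x - b * y - c * z) / a) y z).
    by rewrite lin_pt mulrC divfK // /w addrA; congr (_ *: _ + _ + _); rewrite /m; ring.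
  by rewrite H' E H.
pose r := spec 0 (chart p 0 w F).
have rE x : r.[x] = F.@[(x *: p + w) ord0].
  by rewrite /r horner_spec horner_chart scale0r addr0.
have rper k : r.[m *+ k] = r.[0].
  by elim: k => [|k IHk]; rewrite ?mulr0n // mulrSr rE per -rE.
pose r' : {poly K} := r - (r.[0])%:P.
have rC : r' = 0.
  apply/eqP; apply: contraT => r0.
  (* In characteristic 0 the multiples of the period [m] are distinct roots of [r'], as many as its
     size: one too many. *)
  pose s := [seq m *+ k | k <- iota 0 (size r')].
  have : (size s < size r')%N.
    apply: max_poly_roots => //.
      apply/allP => _ /mapP[k _ ->]; apply/rootP.
      by rewrite /r' hornerD hornerN hornerC rper subrr.
    rewrite map_inj_uniq ?iota_uniq // => i j /eqP.
    wlog ij : i j / (i <= j)%N.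
      by case: (leqP i j) => [|/ltnW] ij W; [|rewrite eq_sym]; move/W => ->.
    rewrite eq_sym -subr_eq0 -mulrnBr // -mulr_natr mulf_eq0 (negPf m0) /=.
    by have /pcharf0P -> := charK0; rewrite subn_eq0 => ji; apply/eqP; rewrite eqn_leq ij.
  by rewrite size_map size_iota ltnn.
have [_ top] := chart_top p 0 w homF.
have : r'`_d = 1.
  by rewrite coefB coef_spec top Fp hornerC coefC gtn_eqF ?subr0 // ltnW.
by rewrite rC coef0 => /esym/eqP; rewrite oner_eq0.
Qed.

Definition fvec (f : 3.-tuple {mpoly K[3]}) v : 'rV[K]_3 := \row_i (tnth f i).@[v ord0].

Lemma meval_fvec f G v : G.@[(fvec f v) ord0] = (G \mPo f).@[v ord0].
Proof. by rewrite comp_mpoly_meval; apply: meval_eq => i; rewrite mxE. Qed.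

Lemma fvec_linear (phi : 'rV[K]_3 -> K) e (f : 3.-tuple {mpoly K[3]}) :
  (forall a v w, phi (a *: v + w) = a * phi v + phi w) ->
  (forall i, tnth f i \is e.-homog) ->
  exists2 h : {mpoly K[3]}, h \is e.-homog & forall v, h.@[v ord0] = phi (fvec f v).
Proof.
move=> /linear_form[l El] hf; exists (\sum_i l i ord0 *: tnth f i).
  by apply: rpred_sum => i _; apply: rpredZ.
move=> v; rewrite -El mxE raddf_sum; apply: eq_bigr => i _.
by rewrite /= mevalZ mxE mulrC.
Qed.

Lemma galois_linear e (f : 3.-tuple {mpoly K[3]}) :
  (forall i, tnth f i \is e.-homog) ->
  generic_on_curve q1 q2 (fun v => F.@[(fvec f v) ord0] = 0) ->
  generic_on_curve q1 q2 (fun v => cy (fvec f v) * cz v = cz (fvec f v) * cy v) ->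
  ~ generic_on_curve q1 q2 (fun v => cy (fvec f v) = 0 /\ cz (fvec f v) = 0) ->
  exists a b c, (forall v, F.@[(lin a b c v) ord0] = a ^+ d * F.@[v ord0]) /\
    generic_on_curve q1 q2 (fun v => exists2 k, k != 0 & fvec f v = k *: lin a b c v).
Proof.
move=> hf fF fyz nz.
have [h0 hh0 E0] := fvec_linear (fun a v w => let: And3 E _ _ := coord_linear a v w in E) hf.
have [h1 hh1 E1] := fvec_linear (fun a v w => let: And3 _ E _ := coord_linear a v w in E) hf.
have [h2 hh2 E2] := fvec_linear (fun a v w => let: And3 _ _ E := coord_linear a v w in E) hf.
have g2 : generic_on_curve q1 q2 (fun v => h2.@[v ord0] != 0).
  (* Were [h2] zero on the curve, so would be [h1], as [cz] is 1 in the chart; then the projection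
     of the image would be undefined. *)
  have [z2|//] := homog_dichotomy hh2; case: nz.
  apply: generic_mono fyz => t Pt x Fx; have := Pt x Fx.
  have z := z2 _ (neq12 x t) Fx; rewrite -E2 z mul0r.
  by case: (coord1 x t) => _ _ ->; rewrite mulr1 => ->.
have [||a [b [c L]]] := linearize hh0 hh1 hh2 g2.
- by apply: generic_on_curve_mono fyz => // v _ _; rewrite E1 E2.
- by apply: generic_on_curve_mono fF => // v _ _; rewrite E0 E1 E2 -dec.
have prop : generic_on_curve q1 q2 (fun v => exists2 k, k != 0 & fvec f v = k *: lin a b c v).
  apply: generic_mono (generic_and L (generic_and fyz g2)) => t [Lt [Pt gt]] x Fx.
  move: (Lt x Fx) (Pt x Fx) (gt x Fx); set v := _ + q2.
  rewrite E0 E2 => L1 P1 z2; exists (cz (fvec f v)) => //.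
  have z1 : cz v = 1 by case: (coord1 x t).
  move: L1 P1; rewrite z1 !mulr1 => L1 P1.
  by rewrite {1}(dec (fvec f v)) L1 P1 /lin z1 mulr1 !scalerDr !scalerA mulr1.
exists a, b, c; split=> //; apply: lin_preserves.
apply: generic_mono (generic_and prop fF) => t [Pt Ft] x Fx.
have [k k0 E] := Pt x Fx; move: (Ft x Fx); rewrite E (dhomog_scale _ _ homF) => /eqP.
by rewrite mulf_eq0 expf_eq0 (negPf k0) andbF => /eqP.
Qed.

(** Tuples that follow the same linear map up to scalars have the same class, so an element of the
    group is determined by [a], [b] and [c]. *)
Lemma rat_eq_transfer a b c (f f' g : 3.-tuple {mpoly K[3]}) :
  ratrep F f' ->
  generic_on_curve q1 q2 (fun v => exists2 k, k != 0 & fvec f v = k *: lin a b c v) ->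
  generic_on_curve q1 q2 (fun v => exists2 k, k != 0 & fvec f' v = k *: lin a b c v) ->
  Defs.rat_eq F f g -> Defs.rat_eq F f' g.
Proof.
move=> rf' gf gf' [rf rg fg]; split=> // i j.
have [[e' he'] _] := rf'; have [[eg heg] _] := rg.
apply: (@generic_on_curve_vanishes_on (e' + eg)).
  by apply: rpredB; apply: dhomogM.
apply: generic_mono (generic_and gf gf') => t [Pt Pt'] x Fx.
have [k k0 E] := Pt x Fx; have [k' k'0 E'] := Pt' x Fx.
have := fg i j _ (neq12 x t) Fx; set v := _ + q2 in E E' *.
have F1 m : (tnth f m).@[v ord0] = k * lin a b c v ord0 m.
  by have := congr1 (fun u : 'rV[K]_3 => u ord0 m) E; rewrite !mxE.
have F2 m : (tnth f' m).@[v ord0] = k' * lin a b c v ord0 m.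
  by have := congr1 (fun u : 'rV[K]_3 => u ord0 m) E'; rewrite !mxE.
rewrite !mevalB !mevalM !F1 !F2 -!mulrA -!mulrBr => /eqP.
by rewrite mulf_eq0 (negPf k0) => /eqP ->; rewrite mulr0.
Qed.

Definition preserves a b c :=
  forall v, F.@[(lin a b c v) ord0] = a ^+ d * F.@[v ord0].

Lemma preserves1 : preserves 1 0 0.
Proof. by move=> v; rewrite /lin expr1n !mul1r !mul0r !addr0 -dec. Qed.

Lemma preservesM a b c a' b' c' : preserves a b c -> preserves a' b' c' ->
  preserves (a * a') (a * b' + b) (a * c' + c).
Proof.
move=> H H' v; rewrite exprMn -mulrA -H' -H.
rewrite [in X in lin a b c X]/lin lin_pt /lin.
have -> : a * a' * cx v + (a * b' + b) * cy v + (a * c' + c) * cz v =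
  a * (a' * cx v + b' * cy v + c' * cz v) + b * cy v + c * cz v by ring.
by [].
Qed.

(** The map sends the [d >= 2] curve points of a generic line through [p] into themselves, acting on
    [x] with slope [a]. So [a] is a quotient of differences of their coordinates. *)
Lemma preserves_finite : exists s : seq K, forall a b c, preserves a b c -> a \in s.
Proof.
have [t [rs [urs srs E]]] := generic_ex (generic_roots charK0 m1 s1).
rewrite size_chart /= in srs.
have rsP x : (x \in rs) = (F.@[(x *: p + t *: q1 + q2) ord0] == 0).
  by rewrite -horner_chart -/f1 -horner_spec E -root_prod_XsubC.
pose x1 := rs`_0; pose x2 := rs`_1.
have r1 : x1 \in rs by rewrite mem_nth // srs ltnW.
have r2 : x2 \in rs by rewrite mem_nth // srs.
have x12 : x1 - x2 != 0.
  by rewrite subr_eq0 /x1 /x2 nth_uniq ?srs // ltnW.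
exists [seq (y1 - y2) / (x1 - x2) | y1 <- rs, y2 <- rs] => a b c H.
have im x : x \in rs -> a * x + (b * t + c) \in rs.
  rewrite !rsP -[q2]scale1r => /eqP Fx; apply/eqP.
  by have := H (pt x t 1); rewrite lin_pt Fx mulr0 mulr1 addrA.
apply/allpairsP; exists (a * x1 + (b * t + c), a * x2 + (b * t + c)); split; try exact: im.
by rewrite /= opprD addrACA subrr addr0 -mulrBr mulfK.
Qed.

Lemma preserves_cyclic : exists N zeta b c, [/\ (0 < N)%N, N.-primitive_root zeta,
  preserves zeta b c & exists2 rs : seq K, size rs = N &
    forall a b c, preserves a b c -> a \in rs].
Proof.
have [s Hs] := preserves_finite.
pose G (a : K) := `[< exists b c, preserves a b c >].
pose rs := [seq a <- undup s | G a].
have urs : uniq rs by rewrite filter_uniq ?undup_uniq.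
have GP a : a \in rs <-> exists b c, preserves a b c.
  rewrite mem_filter mem_undup; split=> [/andP[/asboolP]//|Ga].
  have -> : G a by apply/asboolP.
  by have [b [c /Hs]] := Ga.
have rs1 : 1 \in rs by apply/GP; exists 0, 0; apply: preserves1.
have rs0 a : a \in rs -> a != 0 by move/GP=> [b [c /lin_neq0]].
have N0 : (0 < size rs)%N by case: (rs) rs1.
have rsN a : a \in rs -> a ^+ size rs = 1.
  move=> ars; have a0 := rs0 a ars.
  (* Multiplication by [a] permutes [rs], and comparing products gives [a ^+ size rs = 1]. Then [rs]
     consists of [size rs] distinct roots of unity, one of which is primitive. *)
  have pe : perm_eq [seq a * z | z <- rs] rs.
    have ua : uniq [seq a * z | z <- rs] by rewrite map_inj_uniq //; apply: mulfI.
    have /(uniq_min_size ua) : {subset [seq a * z | z <- rs] <= rs}.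
      move=> _ /mapP[z zrs ->]; apply/GP.
      have /GP[b [c H]] := ars; have /GP[b' [c' H']] := zrs.
      by do 2!eexists; apply: preservesM H H'.
    by rewrite size_map leqnn => /(_ isT)[_ e]; apply: uniq_perm.
  have := perm_big _ pe : \prod_(z <- _) z = \prod_(z <- rs) z.
  rewrite big_map big_split /= big_const_seq count_predT iter_mulr_1 => E.
  have P0 : \prod_(z <- rs) z != 0.
    by rewrite prodf_seq_neq0; apply/allP => z /rs0.
  by apply: (mulIf P0); rewrite E mul1r.
have /hasP[zeta zrs prim] : has (size rs).-primitive_root rs.
  apply: has_prim_root => //; apply/allP => a /rsN ars.
  by rewrite unity_rootE ars.
have /GP[b [c H]] := zrs.
exists (size rs), zeta, b, c; split=> //; exists rs => // a b' c' Ha.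
by apply/GP; exists b', c'.
Qed.

(** The fixed points of [lin zeta b c] other than [p] form the line [x = b' y + c' z], whose
    equation, normalized at [p], is [l]. *)
Lemma homology_of_lin N zeta b c : (1 < N)%N -> N.-primitive_root zeta ->
  preserves zeta b c -> homology F N p.
Proof.
move=> N1 prim H.
have z1 : 1 - zeta != 0.
  rewrite subr_eq0 eq_sym -[zeta]expr1; apply/eqP => /eqP.
  by rewrite -(prim_order_dvd prim) dvdn1 gtn_eqF.
pose b' := b / (1 - zeta); pose c' := c / (1 - zeta).
pose phi v := cx v - (b' * cy v + c' * cz v).
have [|l El] := linear_form (phi := phi).
  by move=> k v w; have [E1 E2 E3] := coord_linear k v w; rewrite /phi E1 E2 E3; ring.
have linE v : lin zeta b c v = v + ((zeta - 1) * phi v) *: p.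
  have Ex : zeta * cx v + b * cy v + c * cz v = cx v + (zeta - 1) * phi v.
    by rewrite /phi /b' /c'; field.
  transitivity (pt (cx v) (cy v) (cz v) + ((zeta - 1) * phi v) *: p); last by rewrite -dec.
  by rewrite /lin Ex scalerDl -!addrA; congr (_ + _); rewrite addrC addrA.
(* Invariance holds so far up to the factor [zeta ^+ d]. A point of the axis off the curve is fixed,
   so the factor is 1. *)
have zd : zeta ^+ d = 1.
  have [v [Ev Fv]] := no_line b' c'; apply: (mulIf Fv).
  by rewrite -H linE /phi Ev subrr mulr0 scale0r addr0 mul1r.
exists zeta, l; split=> //; last by move=> v; rewrite El -linE H zd mul1r.
rewrite El /phi; have Ep : p = pt 1 0 0 by rewrite scale1r !scale0r !addr0.
by rewrite {1 2 3}Ep cxE cyE czE !mulr0 addr0 subr0.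
Qed.

End Charts.
End Curve.

(** * From birational maps to homologies *)

Lemma closed_field_root (K : closedFieldType) (n : nat) (a : K) :
  (0 < n)%N -> exists x, x ^+ n = a.
Proof.
move=> n0; have : size ('X^n - a%:P) != 1 by rewrite size_XnsubC // eqSS -lt0n.
move/closed_rootP => [x /rootP]; rewrite hornerD hornerN hornerXn hornerC => /eqP.
by rewrite subr_eq0 => /eqP; exists x.
Qed.

Lemma card_II_le (T : pointedType) (n : nat) (S : set T) : `I_n #<= S ->
  exists g : nat -> T, (forall i, (i < n)%N -> S (g i)) /\
    (forall i j, (i < n)%N -> (j < n)%N -> g i = g j -> i = j).
Proof.
move=> /pcard_leP/injfunPex[g gS ginj]; exists g; split=> // i j ni nj.
by apply: ginj; rewrite inE.
Qed.

Section Link.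
Variable K : closedFieldType.
Hypothesis charK0 : [pchar K] =i pred0.
Variables (d : nat) (F : {mpoly K[3]}).
Hypothesis d_gt1 : (1 < d)%N.
Hypothesis smF : smooth_plane_curve d F.

Let homF : F \is d.-homog. Proof. by case: smF. Qed.

(** Only [n <= N] is claimed: it suffices to inject the given elements of the group into the list of
    multipliers [a], and a larger [N] only strengthens the bounds. *)
Lemma galois_homology (P : ppoint K) n : ~ on_curve F P -> (1 < n)%N ->
  `I_n #<= galois_group F P ->
  exists N k, [/\ (n <= N)%N, k != 0 & homology F N (k *: coords P)].
Proof.
move=> FP n1 /card_II_le[g [gG ginj]].
have [k Ek] := @closed_field_root K d (F.@[coords P ord0])^-1 (ltnW d_gt1).
have k0 : k != 0.
  apply: contra_not_neq FP => k0; move/esym/eqP: Ek.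
  by rewrite k0 expr0n gtn_eqF ?(ltnW d_gt1) // invr_eq0 => /eqP.
set A := Defs.proj_mx P.
have /andP[/eqP rA /eqP cA] := xchooseP (proj_mx_ex P); rewrite -/(Defs.proj_mx P) -/A in rA cA.
have [p [pE Fp p0 pA]] : exists p : 'rV[K]_3,
    [/\ p = k *: coords P, F.@[p ord0] = 1, p != 0 & p *m A = 0].
  exists (k *: coords P); split=> //.
  - by rewrite (dhomog_scale _ _ homF) Ek mulVf //; apply/eqP.
  - by rewrite scaler_eq0 negb_or k0 coords_neq0.
  - by rewrite -scalemxAl cA scaler0.
(* The rows of a left inverse of the projection matrix complete [p] to a basis in which the
   projection is [(y : z)]. *)
have /row_fullP[B BA] : row_full A by rewrite /row_full rA.
pose q1 := row ord0 B; pose q2 := row ord_max B.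
pose cx (v : 'rV[K]_3) : K := ((v - v *m A *m B) *m pinvmx p) ord0 ord0.
pose cy (v : 'rV[K]_3) : K := (v *m A) ord0 ord0.
pose cz (v : 'rV[K]_3) : K := (v *m A) ord0 ord_max.
have rp : row_free p by rewrite /row_free rank_rV p0.
have AB (v : 'rV[K]_3) : v *m A *m B = cy v *: q1 + cz v *: q2.
  rewrite mulmx_sum_row !big_ord_recl big_ord0 addr0.
  by have -> : lift ord0 ord0 = ord_max :> 'I_2 by apply/val_inj.
have kerp (v : 'rV[K]_3) : ((v - v *m A *m B) <= p)%MS.
  have : (v - v *m A *m B <= kermx A)%MS.
    by apply/sub_kermxP; rewrite mulmxBl -!mulmxA BA mulmx1 subrr.
  have : (p <= kermx A)%MS by apply/sub_kermxP.
  move=> pk; have /eqmxP/eqmx_sym E : (p == kermx A)%MS.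
    by rewrite -(geq_leqif (mxrank_leqif_eq pk)) mxrank_ker rA rank_rV p0.
  by rewrite E.
have dec (v : 'rV[K]_3) : v = cx v *: p + cy v *: q1 + cz v *: q2.
  rewrite -addrA -AB; have := mulmxKpV (kerp v).
  by rewrite [_ *m pinvmx p]mx11_scalar mul_scalar_mx -/(cx v) => ->; rewrite subrK.
have qA1 : q1 *m A = delta_mx 0 ord0 by rewrite -row_mul BA row1.
have qA2 : q2 *m A = delta_mx 0 ord_max by rewrite -row_mul BA row1.
have ptA x y z : (x *: p + y *: q1 + z *: q2) *m A = y *: delta_mx 0 ord0 + z *: delta_mx 0 ord_max.
  by rewrite !mulmxDl -!scalemxAl pA qA1 qA2 scaler0 add0r.
have cyE x y z : cy (x *: p + y *: q1 + z *: q2) = y.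
  by rewrite /cy ptA !mxE /= mulr1 mulr0 addr0.
have czE x y z : cz (x *: p + y *: q1 + z *: q2) = z.
  by rewrite /cz ptA !mxE /= mulr1 mulr0 add0r.
have cxE x y z : cx (x *: p + y *: q1 + z *: q2) = x.
  rewrite /cx AB cyE czE -[x *: p + _ + _]addrA addrK -scalemxAl.
  by rewrite -[p in p *m _]mul1mx mulmxKp // !mxE eqxx mulr1.
have neq x t : x *: p + t *: q1 + q2 != 0.
  apply/eqP => /(congr1 cz); rewrite -[q2]scale1r czE /cz mul0mx mxE => /eqP.
  by rewrite oner_eq0.
have gal tau : galois_group F P tau -> exists f a b c,
    [/\ ratrep F f, tau = ratmap F f, preserves d F p q1 q2 cx cy cz a b c &
      generic_on_curve F p q1 q2 (fun v => exists2 k, k != 0 & fvec f v = k *: lin p q1 q2 cx cy cz a b c v)].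
  move=> [[f [[rf vF] _] ->] [f' [_ rf' ff'] [[_ rpf'] _ pf']]].
  have [[e he] [i0 ni0]] := rf; have [[e' he'] [j0 nj0]] := rf'.
  have [//|gi0] := homog_dichotomy charK0 smF Fp dec cxE cyE czE (he i0).
  have [//|gj0] := homog_dichotomy charK0 smF Fp dec cxE cyE czE (he' j0).
  (* [f] witnesses that [tau] is birational, [f'] that it is compatible with the projection. They
     represent the same map, so they are proportional wherever both are nonzero. *)
  have prop : generic_on_curve F p q1 q2 (fun v => exists2 m, m != 0 & fvec f' v = m *: fvec f v).
    apply: generic_mono (generic_and gi0 gj0) => t [Pi Pj] x Fx.
    move: (Pi x Fx) (Pj x Fx); set v := _ + q2 => fi fj.
    have E i : (tnth f i0).@[v ord0] * (tnth f' i).@[v ord0] = (tnth f' i0).@[v ord0] * (tnth f i).@[v ord0].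
      have := ff' i0 i v (neq x t) Fx; rewrite mevalB !mevalM => /eqP.
      by rewrite subr_eq0 => /eqP ->; rewrite mulrC.
    have E' i : (tnth f' i).@[v ord0] = (tnth f' i0).@[v ord0] / (tnth f i0).@[v ord0] * (tnth f i).@[v ord0].
      by apply: (mulfI fi); rewrite E mulrA [_ * (_ / _)]mulrC divfK.
    exists ((tnth f' i0).@[v ord0] / (tnth f i0).@[v ord0]).
      by apply: contraNneq fj => m0; rewrite E' m0 mul0r.
    by apply/rowP => i; rewrite !mxE [LHS]E'.
  have projE (h : 3.-tuple {mpoly K[3]}) j (v : 'rV[K]_3) :
      (tnth (rat_comp (Defs.proj P) h) j).@[v ord0] = (fvec h v *m A) ord0 j.
    rewrite tnth_mktuple comp_mpoly_meval tnth_mktuple raddf_sum mxE.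
    by apply: eq_bigr => i _; rewrite /= mevalZ mevalXU mxE mulrC.
  have projE' j (v : 'rV[K]_3) : (tnth (Defs.proj P) j).@[v ord0] = (v *m A) ord0 j.
    rewrite tnth_mktuple raddf_sum mxE.
    by apply: eq_bigr => i _; rewrite /= mevalZ mevalXU mulrC.
  have cyZ m (v : 'rV[K]_3) : cy (m *: v) = m * cy v by rewrite /cy -scalemxAl mxE.
  have czZ m (v : 'rV[K]_3) : cz (m *: v) = m * cz v by rewrite /cz -scalemxAl mxE.
  have [||| a [b [c [H G]]]] := galois_linear charK0 d_gt1 smF Fp dec cxE cyE czE he.
  - apply: generic_all => t x Fx; rewrite meval_fvec; exact: vF (neq x t) Fx.
  - apply: generic_mono prop => t Pt x Fx; have [m m0 E] := Pt x Fx.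
    have := pf' ord0 ord_max _ (neq x t) Fx; rewrite mevalB !mevalM !projE !projE' E.
    rewrite -/(cy _) -/(cz _) -/(cy (_ *: _)) -/(cz (_ *: _)) cyZ czZ -!mulrA -mulrBr => /eqP.
    by rewrite mulf_eq0 (negPf m0) subr_eq0 => /eqP.
  - move=> fz; case: rpf' => j; apply.
    have [e1 hj] : exists e1, tnth (rat_comp (Defs.proj P) f') j \is e1.-homog.
      exists e'; rewrite tnth_mktuple tnth_mktuple raddf_sum.
      apply: rpred_sum => i _; rewrite /= comp_mpolyZ; apply: rpredZ.
      by rewrite comp_mpolyXU -tnth_nth.
    apply: (generic_on_curve_vanishes_on charK0 smF Fp dec cxE cyE czE hj).
    apply: generic_mono (generic_and prop fz) => t [Pt Zt] x Fx.
    have [m m0 E] := Pt x Fx; have [y0 z0] := Zt x Fx.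
    rewrite projE E -scalemxAl mxE.
    have [->|->] : j = ord0 \/ j = ord_max.
      by case: j {hj} => -[|[|//]] ij; [left|right]; apply/val_inj.
    - by rewrite -/(cy _) y0 mulr0.
    - by rewrite -/(cz _) z0 mulr0.
  by exists f, a, b, c; split.
have [N [zeta [b [c [N0 prim pres [rs srs allrs]]]]]] :=
  preserves_cyclic charK0 d_gt1 smF Fp dec cxE cyE czE.
have nN : (n <= N)%N.
  (* [al i] is the multiplier of the [i]-th element, with a dummy value beyond [n]. It is injective
     below [n] because the multiplier determines the whole linear map. *)
  have /choice[al Hal] : forall i, exists a, (i < n)%N -> exists f b c,
    [/\ ratrep F f, g i = ratmap F f, preserves d F p q1 q2 cx cy cz a b c &
      generic_on_curve F p q1 q2 (fun v => exists2 k, k != 0 & fvec f v = k *: lin p q1 q2 cx cy cz a b c v)].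
    move=> i; case: (ltnP i n) => [ni|_]; last by exists 0.
    by have [f [a [b' [c' H]]]] := gal _ (gG i ni); exists a => _; exists f, b', c'.
  rewrite -srs -(size_iota 0 n) -(size_map al); apply: uniq_leq_size.
    rewrite map_inj_in_uniq ?iota_uniq // => i j; rewrite !mem_iota !add0n => ni nj aij.
    apply: ginj => //.
    have [f [b1 [c1 [rf -> pr gf]]]] := Hal i ni.
    have [f' [b2 [c2 [rf' -> pr' gf']]]] := Hal j nj.
    rewrite -aij in pr' gf'.
    have [eb ec] := lin_determined charK0 d_gt1 smF Fp dec cxE cyE czE pr pr'.
    rewrite -eb -ec in gf'.
    apply/seteqP; split=> h /=.
      exact: (rat_eq_transfer charK0 smF Fp dec cxE cyE czE rf' gf gf').
    exact: (rat_eq_transfer charK0 smF Fp dec cxE cyE czE rf gf' gf).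
  move=> _ /mapP[i + ->]; rewrite mem_iota add0n => ni.
  by have [f [b1 [c1 [_ _ pr _]]]] := Hal i ni; apply: allrs pr.
exists N, k; split=> //; rewrite -pE.
exact: (homology_of_lin charK0 d_gt1 smF Fp dec cxE cyE czE (leq_trans n1 nN) prim pres).
Qed.
End Link.

(** * Homologies and the Hessian *)

Lemma base_digits_inj (B a0 a1 a2 b0 b1 b2 : nat) :
  (a0 < B)%N -> (a1 < B)%N -> (b0 < B)%N -> (b1 < B)%N ->
  (a0 + (a1 + a2 * B) * B = b0 + (b1 + b2 * B) * B)%N ->
  [/\ a0 = b0, a1 = b1 & a2 = b2].
Proof.
move=> a0B a1B b0B b1B E.
have digits u v x y : (u < B)%N -> (v < B)%N -> (u + x * B = v + y * B)%N -> u = v /\ x = y.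
  move=> uB vB xy; have B0 : (0 < B)%N by apply: leq_ltn_trans uB.
  have uv : u = v by have := congr1 (modn^~ B) xy; rewrite /= (addnC u) (addnC v) !modnMDl !modn_small.
  by split=> //; move/eqP: xy; rewrite uv eqn_add2l eqn_pmul2r // => /eqP.
have [-> /digits[|//|-> ->]] := digits _ _ _ _ a0B b0B E; by [].
Qed.

(* Kronecker's substitution [X_i := x ^ (B ^ i)]. *)
Lemma mpoly3_eval_eq0 (K : closedFieldType) (h : {mpoly K[3]}) :
  (forall v : 'rV[K]_3, h.@[v ord0] = 0) -> h = 0.
Proof.
move=> h0; pose B := msize h.
pose g := mmap (@polyC K) (fun i : 'I_3 => 'X ^+ (B ^ i)) h.
have g0 : g = 0.
  apply: generic_eq0; apply: generic_all => x.
  rewrite -(h0 (\row_i x ^+ (B ^ i))); apply: (mmap_rmorph (g := horner_eval x) (f' := idfun)) => [c|i] /=.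
    by rewrite /horner_eval hornerC.
  by rewrite /horner_eval hornerXn mxE.
(* All exponents in [h] are less than [B], so [e] reads them as digits in base [B] and separates the
   monomials of [h]. *)
pose e (m : 'X_{1..3}) := (m ord0 + (m 1%R + m 2%R * B) * B)%N.
have mm (m : 'X_{1..3}) : mmap1 (fun i : 'I_3 => 'X ^+ (B ^ i)) m = 'X ^+ e m :> {poly K}.
  rewrite /mmap1 !big_ord_recl big_ord0 /= mulr1 -!exprM -!exprD; congr ('X ^+ _).
  have -> : lift ord0 ord0 = 1%R :> 'I_3 by apply/val_inj.
  have -> : lift ord0 (lift ord0 ord0) = 2%R :> 'I_3 by apply/val_inj.
  by rewrite /e /bump /= !expnS expn0; lia.
apply/mpolyP => m; rewrite mcoeff0.
case: (boolP (m \in msupp h)) => [mh|]; last by rewrite mcoeff_msupp negbK => /eqP.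
have := congr1 (fun q : {poly K} => q`_(e m)) g0.
rewrite coef0 /g /mmap coef_sum (bigD1_seq m) ?msupp_uniq //= mm coefCM coefXn eqxx mulr1.
rewrite big_seq_cond big1 ?addr0 // => m' /andP[m'h mm'].
rewrite mm coefCM coefXn; case: eqP => [E|_]; last by rewrite mulr0.
case/eqP: mm'.
have lt (m1 : 'X_{1..3}) i : m1 \in msupp h -> (m1 i < B)%N.
  move=> /msize_mdeg_lt; apply: leq_ltn_trans.
  by rewrite mdegE (bigD1 i) //= leq_addr.
have [e0 e1 e2] := base_digits_inj (lt _ _ mh) (lt _ _ mh) (lt _ _ m'h) (lt _ _ m'h) E.
apply/mnmP => i; have : i \in [:: ord0; 1%R; 2%R] by case: i => -[|[|[|]]].
by rewrite !inE => /or3P[] /eqP ->.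
Qed.

Lemma prim_unity_neq0 (K : fieldType) n (z : K) : n.-primitive_root z -> z != 0.
Proof.
move=> prim; apply/eqP => z0; have := prim_expr_order prim.
rewrite z0 expr0n gtn_eqF ?(prim_order_gt0 prim) // => /esym/eqP.
by rewrite oner_eq0.
Qed.

Section Dird.
Variables (K : fieldType) (n : nat).
Implicit Types (h a b : {mpoly K[n]}) (w : 'rV[K]_n).

Lemma dirdD w : {morph dird w : a b / a + b}.
Proof.
move=> a b; rewrite /dird -big_split; apply: eq_bigr => i _ /=.
by rewrite mderivD scalerDr.
Qed.

Lemma dirdM w a b : dird w (a * b) = dird w a * b + a * dird w b.
Proof.
rewrite /dird mulr_suml mulr_sumr -big_split; apply: eq_bigr => i _ /=.
have -> : (a * b)^`M(i) = a^`M(i) * b + a * b^`M(i) by exact: mderivM.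
by rewrite scalerDr -scalerAl -scalerAr.
Qed.

Lemma dirdC w c : dird w c%:MP = 0.
Proof. by rewrite /dird big1 // => i _; rewrite mderivC scaler0. Qed.

Lemma dirdX w i : dird w 'X_i = (w ord0 i)%:MP.
Proof.
rewrite /dird (bigD1 i) //= big1 ?addr0 => [|j ji].
  by rewrite mderivX mnm1E eqxx scale1r -{1}[U_(i)%MM]add0m addmK mpolyX0 -mul_mpolyC mulr1.
by rewrite mderivX mnm1E eq_sym (negPf ji) scale0r scaler0.
Qed.

Lemma dirdZ w c h : dird w (c *: h) = c *: dird w h.
Proof. by rewrite -!mul_mpolyC dirdM dirdC mul0r add0r. Qed.

Lemma dird_form w l : dird w (lform l) = ((w *m l) ord0 ord0)%:MP.
Proof.
rewrite /lform (big_morph _ (@dirdD w) (id1 := 0)) ?mxE; last first.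
  by rewrite -mpolyC0 dirdC.
rewrite raddf_sum; apply: eq_bigr => i _ /=.
by rewrite dirdZ dirdX -mul_mpolyC -mpolyCM mulrC.
Qed.

Lemma dird_comm w w' h : dird w (dird w' h) = dird w' (dird w h).
Proof.
have E w1 w2 : dird w1 (dird w2 h) =
    \sum_j \sum_i (w1 ord0 i * w2 ord0 j) *: h^`M(j)^`M(i).
  rewrite {2}/dird (big_morph _ (@dirdD w1) (id1 := 0)); last by rewrite -mpolyC0 dirdC.
  apply: eq_bigr => j _; rewrite dirdZ /dird scaler_sumr.
  by apply: eq_bigr => i _; rewrite scalerA mulrC.
rewrite !E exchange_big; apply: eq_bigr => i _; apply: eq_bigr => j _ /=.
by rewrite mderiv_comm mulrC.
Qed.

Lemma dhomog_dird e w h : h \is e.-homog -> dird w h \is e.-1.-homog.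
Proof.
by move=> hh; apply: rpred_sum => i _; apply: rpredZ; apply: dhomog_deriv.
Qed.

Lemma dird_comp w k (h : {mpoly K[k]}) (t : k.-tuple {mpoly K[n]}) :
  dird w (h \mPo t) = \sum_i (h^`M(i) \mPo t) * dird w (tnth t i).
Proof.
apply: (mmap_derivation (f := @mpolyC n K)); [exact: dirdD|exact: dirdM|exact: dirdC].
Qed.

End Dird.

(** * Divisibility by the equation of the axis *)

Section Axis.
Variable K : closedFieldType.
Hypothesis charK0 : [pchar K] =i pred0.
Implicit Types (h g a b : {mpoly K[3]}) (l : 'cV[K]_3) (p q v w : 'rV[K]_3).

Definition shift w l : 3.-tuple {mpoly K[3]} :=
  [tuple 'X_i + w ord0 i *: lform l | i < 3].

Definition form_dvd l h := exists g, h = lform l * g.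

Lemma comp_shiftX w l i : 'X_i \mPo shift w l = 'X_i + w ord0 i *: lform l.
Proof. by rewrite comp_mpolyXU -tnth_nth tnth_mktuple. Qed.

Lemma comp_shift_form w l :
  lform l \mPo shift w l = (1 + (w *m l) ord0 ord0) *: lform l.
Proof.
rewrite {1}/lform raddf_sum /= (eq_bigr (fun i => l i ord0 *: 'X_i + (w ord0 i * l i ord0) *: lform l)).
  by rewrite big_split /= -scaler_suml scalerDl scale1r mxE.
by move=> i _; rewrite comp_mpolyZ comp_shiftX scalerDr scalerA mulrC.
Qed.

Lemma meval_shift w l h v :
  (h \mPo shift w l).@[v ord0] = h.@[(v + (v *m l) ord0 ord0 *: w) ord0].
Proof.
rewrite comp_mpoly_meval; apply: meval_eq => i.
by rewrite tnth_mktuple mevalD mevalXU mevalZ meval_lform !mxE mulrC.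
Qed.

Lemma comp_shift_dvd w l h : form_dvd l (h \mPo shift w l - h).
Proof.
elim/mpoly_ringind: h => [c|i|a b [g1 E1] [g2 E2]|a b [g1 E1] [g2 E2]].
- by exists 0; rewrite comp_mpolyC subrr mulr0.
- exists (w ord0 i)%:MP; rewrite comp_shiftX addrAC subrr add0r.
  by rewrite mulrC mul_mpolyC.
- exists (g1 + g2); rewrite raddfD /= opprD addrACA E1 E2 mulrDr //.
- exists (g1 * (b \mPo shift w l) + a * g2).
  rewrite rmorphM mulrDr [_ * (a * _)]mulrCA -E2 mulrA -E1; ring.
Qed.

Section Center.
Variables (l : 'cV[K]_3) (p : 'rV[K]_3).
Hypothesis lp : (p *m l) ord0 ord0 = 1.

(** The map behind [shift (- p) l] is the projection onto the axis along [p]: the substitution kills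
    [l] and is the identity modulo [l]. Divisibility by [l] is thus the kernel of a ring morphism
    into a domain, and [l] is prime. *)
Lemma form_dvdP h : form_dvd l h <-> h \mPo shift (- p) l = 0.
Proof.
split=> [[g ->]|E].
  by rewrite rmorphM /= comp_shift_form mulNmx mxE lp subrr scale0r mul0r.
have [g Eg] := comp_shift_dvd (- p) l h; exists (- g).
by rewrite mulrN -Eg E sub0r opprK.
Qed.

Lemma form_prime a b : form_dvd l (a * b) -> form_dvd l a \/ form_dvd l b.
Proof.
by rewrite !form_dvdP rmorphM /= => /eqP; rewrite mulf_eq0 => /orP[]/eqP; [left|right].
Qed.

Lemma lform_neq0 : lform l != 0.
Proof.
apply: contra_eq_neq lp => l0; rewrite -meval_lform l0 meval0.
by rewrite eq_sym oner_neq0.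
Qed.

Lemma form_exp_dvd k a b : ~ form_dvd l a ->
  (exists g, a * b = lform l ^+ k * g) -> exists g, b = lform l ^+ k * g.
Proof.
move=> na; elim: k b => [|k IHk] b [g E]; first by exists b; rewrite mul1r.
have [|/na[]|[b' E']] := @form_prime a b.
  by exists (lform l ^+ k * g); rewrite E exprS mulrA.
have [|g' E''] := IHk b'.
  exists g; apply: (mulfI lform_neq0); rewrite mulrCA -E' E exprS; ring.
by exists g'; rewrite E' E'' exprS mulrA.
Qed.

Lemma msize_lform : (1 < msize (lform l))%N.
Proof.
rewrite ltnNge; apply/negP => /msize1_polyC E1.
have := lp; rewrite -meval_lform E1 mevalC.
have := meval_lform l 0; rewrite E1 mevalC mul0mx mxE => -> /esym/eqP.
by rewrite mpolyC0 mcoeff0 oner_eq0.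
Qed.

Lemma msize_form_exp k h : h != 0 -> (k + msize h <= msize (lform l ^+ k * h))%N.
Proof.
move=> h0; elim: k => [|k IHk]; first by rewrite mul1r.
rewrite exprS -mulrA msizeM ?lform_neq0 ?mulf_neq0 ?expf_neq0 ?lform_neq0 //.
have aux (x y z : nat) : (1 < x)%N -> (k + z <= y)%N -> (k.+1 + z <= (x + y).-1)%N by lia.
exact: aux msize_lform IHk.
Qed.

Lemma form_ndvd1 : ~ form_dvd l 1.
Proof. by rewrite form_dvdP comp_mpoly1 => /eqP; rewrite oner_eq0. Qed.

Lemma form_ndvd_exp k a : ~ form_dvd l a -> ~ form_dvd l (a ^+ k).
Proof.
move=> na; elim: k => [|k IHk]; first by rewrite expr0; apply: form_ndvd1.
by rewrite exprS => /form_prime[].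
Qed.

Lemma form_multiplicity h : h != 0 ->
  exists e g, h = lform l ^+ e * g /\ ~ form_dvd l g.
Proof.
have [n] := ubnP (msize h); elim: n h => // n IHn h sh h0.
case: (pselect (form_dvd l h)) => [[g E]|nd]; last by exists 0%N, h; rewrite mul1r.
have g0 : g != 0 by apply: contraNneq h0 => g0; rewrite E g0 mulr0.
have [|e [g' [E' nd]]] := IHn g _ g0; last first.
  by exists e.+1, g'; rewrite E E' exprS mulrA.
move: sh; rewrite E msizeM ?lform_neq0 //.
have aux (x y : nat) : (1 < x)%N -> ((x + y).-1 < n.+1)%N -> (y < n)%N by lia.
exact: aux msize_lform.
Qed.

(** The substitution is the identity modulo [l], so [(zeta ^+ j - 1) *: h] is divisible by [l]. As
    [l] itself has eigenvalue [zeta], the quotient has eigenvalue [zeta ^+ j.-1], and induction goes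
    on until [j = 0]. *)
Lemma form_eigen zeta n j h : n.-primitive_root zeta -> (j < n)%N ->
  h \mPo shift ((zeta - 1) *: p) l = zeta ^+ j *: h ->
  exists g, h = lform l ^+ j * g.
Proof.
move=> prim; elim: j h => [|j IHj] h jn E; first by exists h; rewrite mul1r.
have zj : zeta ^+ j.+1 - 1 != 0.
  rewrite subr_eq0 -(prim_order_dvd prim); apply/negP => /dvdn_leq; lia.
have z0 : zeta != 0 by apply: prim_unity_neq0 prim.
have [g Eg] := comp_shift_dvd ((zeta - 1) *: p) l h.
pose h1 := (zeta ^+ j.+1 - 1)^-1 *: g.
have Eh : h = lform l * h1.
  by rewrite /h1 -scalerAr -Eg E -[X in _ *: (_ - X)]scale1r -scalerBl scalerA mulVf ?scale1r.
have [|g' Eg'] := IHj h1 (ltnW jn); last by exists g'; rewrite Eh Eg' exprS mulrA.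
have E2 : zeta *: (lform l * (h1 \mPo shift ((zeta - 1) *: p) l)) = zeta *: (lform l * (zeta ^+ j *: h1)).
  have := E; rewrite Eh rmorphM /= comp_shift_form -scalemxAl mxE lp mulr1 addrC subrK.
  by rewrite -!scalerAl exprS -scalerA => ->; rewrite /h1 -!scalerAr.
exact: (mulfI lform_neq0 (scalerI z0 E2)).
Qed.

(* The homology scales its center by [zeta], so [dird p F] is an eigenvector
   for the eigenvalue [zeta ^-1]. *)
Lemma homology_dird F N zeta : (1 < N)%N -> N.-primitive_root zeta ->
  (forall v, F.@[(v + ((zeta - 1) * (v *m l) ord0 ord0) *: p) ord0] = F.@[v ord0]) ->
  exists g, dird p F = lform l ^+ N.-1 * g.
Proof.
move=> N1 prim H; set w := (zeta - 1) *: p.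
have FE : F \mPo shift w l = F.
  apply/eqP; rewrite -subr_eq0; apply/eqP/mpoly3_eval_eq0 => v.
  rewrite mevalB meval_shift /w scalerA mulrC H subrr //.
have z0 : zeta != 0 by apply: prim_unity_neq0 prim.
apply: (form_eigen prim); first by lia.
apply: (scalerI z0); rewrite scalerA -exprS prednK 1?ltnW // (prim_expr_order prim) scale1r.
(* The chain rule: the derivative along [p] of [F \mPo shift w l] is [zeta] times the substituted
   [dird p F]. *)
rewrite -[in RHS]FE dird_comp [in LHS]/dird.
rewrite (raddf_sum (comp_mpoly (shift w l))) /= scaler_sumr; apply: eq_bigr => i _.
rewrite /= comp_mpolyZ tnth_mktuple dirdD dirdZ dirdX dird_form lp.
have -> : (p ord0 i)%:MP + w ord0 i *: 1%:MP = (zeta * p ord0 i)%:MP :> {mpoly K[3]}.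
  by rewrite mxE -mul_mpolyC -mpolyCM -mpolyCD; congr (_%:MP); ring.
by rewrite mulrC mul_mpolyC scalerA.
Qed.

End Center.
End Axis.

Lemma det_mx33 (R : comNzRingType) (A : 'M[R]_3) :
  \det A = A 0 0 * (A 1 1 * A 2%R 2%R - A 1 2%R * A 2%R 1)
         - A 0 1 * (A 1 0 * A 2%R 2%R - A 1 2%R * A 2%R 0)
         + A 0 2%R * (A 1 0 * A 2%R 1 - A 1 1 * A 2%R 0).
Proof.
rewrite (expand_det_row _ 0) !big_ord_recl big_ord0 /cofactor.
rewrite !(expand_det_row _ ord0) !big_ord_recl !big_ord0 /cofactor !det_mx11 !mxE /=.
(* Indexing by natural numbers identifies ordinals that are built in different ways. *)
pose f i j := A (inord i) (inord j).
have AE i j : A i j = f i j by rewrite /f !inord_val.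
by rewrite !AE /= /bump /=; ring.
Qed.

Lemma dird_delta (K : fieldType) n (h : {mpoly K[n]}) j :
  dird (delta_mx 0 j) h = h^`M(j).
Proof.
rewrite /dird (bigD1 j) //= mxE !eqxx scale1r big1 ?addr0 // => i ij.
by rewrite mxE eqxx (negPf ij) scale0r.
Qed.

Lemma dird_formX (K : fieldType) n (l : 'cV[K]_n) (w : 'rV[K]_n) k :
  dird w (lform l ^+ k) = (k%:R * (w *m l) ord0 ord0) *: lform l ^+ k.-1.
Proof.
elim: k => [|k IHk]; first by rewrite expr0 -mpolyC1 dirdC mul0r scale0r.
rewrite exprS dirdM dird_form IHk mul_mpolyC.
case: k {IHk} => [|k]; first by rewrite mul0r scale0r mulr0 addr0 mul1r.
by rewrite -scalerAr -exprS -scalerDl; congr (_ *: _); rewrite [in RHS]mulrSr /=; ring.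
Qed.

(** * The Hessian determinant *)

Section Hessian.
Variable K : closedFieldType.
Hypothesis charK0 : [pchar K] =i pred0.
Variables (d : nat) (F : {mpoly K[3]}).
Hypothesis d_gt1 : (1 < d)%N.
Hypothesis smF : smooth_plane_curve d F.

Let homF : F \is d.-homog. Proof. by case: smF. Qed.

Definition hess : 'M[{mpoly K[3]}]_3 := \matrix_(i, j) F^`M(i)^`M(j).

Lemma hess_homog : \det hess \is (3 * (d - 2)).-homog.
Proof.
apply: rpred_sum => s _.
have H i j : hess i j \is (d - 2).-homog.
  by rewrite mxE subn2; do 2!apply: dhomog_deriv.
have P : \prod_i hess i (s i) \is (3 * (d - 2)).-homog.
  rewrite !big_ord_recl big_ord0 mulr1 !mulSn mul0n addn0.
  by do 2!apply: dhomogM => //.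
by case: (odd_perm s); rewrite ?expr0 ?expr1 ?mul1r ?mulN1r ?rpredN.
Qed.

Lemma mul_hess (u : 'rV[K]_3) j :
  (map_mx (@mpolyC 3 K) u *m hess) ord0 j = (dird u F)^`M(j).
Proof.
rewrite mxE /dird raddf_sum; apply: eq_bigr => i _.
by rewrite !mxE mul_mpolyC /= mderivZ.
Qed.

(** The product of [p] with the Hessian matrix is the gradient of [dird p F], which loses one factor
    [l]. Multiplying by the adjugate turns it into the determinant times [p], and a nonzero
    coordinate of [p] is read off. *)
Lemma hess_dvd N (l : 'cV[K]_3) (p : 'rV[K]_3) : p != 0 -> (1 < N)%N ->
  (exists g, dird p F = lform l ^+ N.-1 * g) ->
  exists g, \det hess = lform l ^+ (N - 2) * g.
Proof.
move=> p0 N1 [g Eg].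
have [i pi0] : exists i, p ord0 i != 0 by apply/rV0Pn.
have [r Er] : exists r : 'rV[{mpoly K[3]}]_3,
    map_mx (@mpolyC 3 K) p *m hess = lform l ^+ (N - 2) *: r.
  exists (\row_j (((N.-1)%:R * l j ord0) *: g + lform l * g^`M(j))).
  apply/rowP => j; rewrite mul_hess Eg !mxE.
  rewrite -dird_delta dirdM dird_formX dird_delta -rowE mxE.
  have -> : (N.-1 = (N - 2).+1)%N by lia.
  by rewrite exprS /= -mul_mpolyC; rewrite -[_ *: g]mul_mpolyC; ring.
have := congr1 (fun A : 'rV[{mpoly K[3]}]_3 => (A *m \adj hess) ord0 i) Er.
rewrite /= -mulmxA mul_mx_adj mul_mx_scalar -scalemxAl mxE [RHS]mxE [X in _ * X = _]mxE => E.
exists ((p ord0 i)^-1 *: (r *m \adj hess) ord0 i).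
by rewrite -scalerAr -E mulrC mul_mpolyC scalerA mulVf // scale1r.
Qed.

Lemma mul_hess2 (u v : 'rV[K]_3) :
  (map_mx (@mpolyC 3 K) u *m hess *m (map_mx (@mpolyC 3 K) v)^T) ord0 ord0 =
  dird v (dird u F).
Proof.
rewrite mxE [RHS]/dird; apply: eq_bigr => j _.
by rewrite mul_hess !mxE mulrC mul_mpolyC.
Qed.

Lemma axis_basis (l : 'cV[K]_3) (p : 'rV[K]_3) : (p *m l) ord0 ord0 = 1 ->
  exists r s : 'rV[K]_3, [/\ (r *m l) ord0 ord0 = 0, (s *m l) ord0 ord0 = 0,
    forall a b, a *: r + b *: s = 0 -> a = 0 /\ b = 0 &
    forall v, exists a b c, v = a *: p + b *: r + c *: s].
Proof.
move=> lp.
have l0 : l != 0.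
  by apply: contra_eq_neq lp => ->; rewrite mulmx0 mxE eq_sym oner_neq0.
have rk : \rank (kermx l) = 2%N.
  by rewrite mxrank_ker -mxrank_tr rank_rV trmx_eq0 l0.
have [C CK fC] : exists2 C : 'M[K]_(2, 3), (C :=: kermx l)%MS & row_free C.
  move: (row_base (kermx l)) (eq_row_base (kermx l)) (row_base_free (kermx l)).
  by rewrite rk => C E fC; exists C.
have Cl : C *m l = 0 by apply/sub_kermxP; rewrite CK.
have uC (u : 'rV[K]_2) : u *m C = u ord0 ord0 *: row ord0 C + u ord0 ord_max *: row ord_max C.
  rewrite mulmx_sum_row !big_ord_recl big_ord0 addr0.
  by have -> : lift ord0 ord0 = ord_max :> 'I_2 by apply/val_inj.
exists (row ord0 C), (row ord_max C); split.
- by rewrite -row_mul Cl !mxE.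
- by rewrite -row_mul Cl !mxE.
- move=> a b E; pose u : 'rV[K]_2 := \row_j (if j == ord0 then a else b).
  have : u *m C = 0 *m C by rewrite uC !mxE /= mul0mx.
  move/(row_free_inj fC) => u0.
  have := (congr1 (fun u : 'rV[K]_2 => (u ord0 ord0, u ord0 ord_max)) u0).
  by rewrite !mxE /= => -[-> ->].
- move=> v; have : (v - (v *m l) ord0 ord0 *: p <= C)%MS.
    rewrite CK; apply/sub_kermxP; rewrite mulmxBl -scalemxAl.
    by rewrite [p *m l]mx11_scalar lp scalemx1 -mx11_scalar subrr.
  move/submxP => [u Eu]; exists ((v *m l) ord0 ord0), (u ord0 ord0), (u ord0 ord_max).
  by rewrite -addrA -uC -Eu addrC subrK.
Qed.

Lemma line_meets_curve (r s : 'rV[K]_3) :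
  (forall a b, a *: r + b *: s = 0 -> a = 0 /\ b = 0) ->
  exists y z, y *: r + z *: s != 0 /\ F.@[(y *: r + z *: s) ord0] = 0.
Proof.
move=> ind; have [Fr|Fr] := eqVneq F.@[r ord0] 0.
  exists 1, 0; rewrite scale1r scale0r addr0; split=> //.
  apply/eqP => r0; have [|/eqP] := ind 1 0; first by rewrite r0 !scale0r scaler0 addr0.
  by rewrite oner_eq0.
have [_ top] := chart_top r 0 s homF.
have : size (spec 0 (chart r 0 s F)) != 1.
  apply: contraNneq Fr => s1; rewrite -(hornerC F.@[r ord0] 0) -top -coef_spec.
  by rewrite nth_default ?s1 // ltnW.
move/closed_rootP => [x /rootP]; rewrite horner_spec horner_chart scale0r addr0 => Fx.
exists x, 1; rewrite scale1r; split=> //; apply/eqP => E.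
by have [|_ /eqP] := ind x 1; rewrite ?scale1r // oner_eq0.
Qed.

Lemma dird_neq0 (p : 'rV[K]_3) : F.@[p ord0] != 0 -> dird p F != 0.
Proof.
apply: contraNneq => dF; have := dird_euler p homF; rewrite dF meval0 => /esym/eqP.
rewrite mulf_eq0; have /pcharf0P -> := charK0.
by rewrite gtn_eqF // ltnW.
Qed.

Lemma natr_neq0 n : (0 < n)%N -> n%:R != 0 :> K.
Proof. by have /pcharf0P -> := charK0; rewrite lt0n. Qed.

(* Let [m l^e] be the exact form of [dird p F]. Dividing the Hessian
   determinant in a basis [p, r, s] by [l^(e - 1)] and restricting to the axis
   leaves [e m] times the Hessian of the binary form [F] on the axis, and a
   binary form whose Hessian vanishes has only multiple zeros. At such a zero
   the curve would be singular, the axis being the polar of [p]. *)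
Lemma hess_neq0 (l : 'cV[K]_3) (p : 'rV[K]_3) : (p *m l) ord0 ord0 = 1 ->
  F.@[p ord0] != 0 -> form_dvd l (dird p F) -> \det hess != 0.
Proof.
move=> lp Fp dvd; apply/eqP => H0.
have [e [m [Em nm]]] := form_multiplicity lp (dird_neq0 Fp).
have e0 : (0 < e)%N.
  by case: e Em => // Em; case: nm; rewrite -[m]mul1r -[1](expr0 (lform l)) -Em.
have [r [s [lr ls ind span]]] := axis_basis lp.
pose T : 'M[K]_3 := \matrix_i (if i == 0 then p else if i == 1 then r else s).
pose TP := map_mx (@mpolyC 3 K) T.
pose W := TP *m hess *m TP^T.
have WE i j : W i j = dird (row j T) (dird (row i T) F).
  rewrite -mul_hess2 mxE [RHS]mxE; apply: eq_bigr => k _; congr (_ * _).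
    by rewrite mxE [RHS]mxE; apply: eq_bigr => k' _; rewrite !mxE.
  by rewrite !mxE.
have W0 : \det W = 0 by rewrite !det_mulmx H0 mulr0 mul0r.
case: e e0 Em => // e _ Em; set L := lform l in Em.
have dp w : (w *m l) ord0 ord0 = 0 -> dird w (dird p F) = L ^+ e * (L * dird w m).
  by move=> lw; rewrite Em dirdM dird_formX lw mulr0 scale0r mul0r add0r exprS; ring.
have dpp : dird p (dird p F) = L ^+ e * (e.+1%:R * m + L * dird p m).
  rewrite Em dirdM dird_formX lp mulr1 /= exprS -/L -mul_mpolyC mpolyC_nat; ring.
move: W0; rewrite det_mx33 !WE !rowK /= (dird_comm p r) (dird_comm p s) (dird_comm r s).
rewrite dpp !dp //; set rr := dird r (dird r F); set ss := dird s (dird s F).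
set rs := dird s (dird r F) => W0.
have [g Eg] : form_dvd l (e.+1%:R * (rr * ss - rs * rs)).
  have [||//] := @form_prime _ l p lp m (e.+1%:R * (rr * ss - rs * rs)); last by move/nm.
  (* After cancelling [L ^+ e], all other terms of the expanded determinant still contain [L]. *)
  pose x1 := L ^+ e * (L * dird r m); pose x2 := L ^+ e * (L * dird s m).
  exists (- (dird p m * (rr * ss - rs * rs) - dird r m * (x1 * ss - rs * x2)
             + dird s m * (x1 * rs - rr * x2))).
  apply: (mulfI (expf_neq0 e (lform_neq0 lp))); apply/eqP; rewrite -subr_eq0; apply/eqP.
  by rewrite -[RHS]W0 /x1 /x2 -/L; ring.
have [y [z [Q0 FQ]]] := line_meets_curve ind.
set Q := y *: r + z *: s in Q0 FQ.
have lQ : (Q *m l) ord0 ord0 = 0.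
  by rewrite mulmxDl -!scalemxAl mxE mxE lr mulr0 mxE ls mulr0 addr0.
have := congr1 (fun h => h.@[Q ord0]) Eg.
rewrite /= !mevalM mevalB !mevalM meval_lform lQ mul0r rmorph_nat => /eqP.
rewrite mulf_eq0 (negPf (natr_neq0 (ltn0Sn e))) /= subr_eq0 => /eqP det0.
have d1 : (0 < d.-1)%N by lia.
have Er := dird_euler Q (dhomog_dird r homF).
have Es := dird_euler Q (dhomog_dird s homF).
have EF := dird_euler Q homF.
rewrite {1}/Q meval_dirdD -/rr -/rs in Er.
rewrite {1}/Q meval_dirdD (dird_comm r s) -/rs -/ss in Es.
rewrite {1}/Q meval_dirdD FQ mulr0 in EF.
move: det0 Er Es EF.
set al := rr.@[_]; set be := rs.@[_]; set ga := ss.@[_].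
set fr := (dird r F).@[_]; set fs := (dird s F).@[_] => det0 Er Es EF.
(* By Euler the two brackets are [d - 1] times [fr] and [fs]. Since [al * ga = be ^ 2], the square
   of the first is [al] times the left side, that of the second [ga] times it; so both vanish. *)
have iso : y * (y * al + z * be) + z * (y * be + z * ga) = 0.
  rewrite Er Es -[RHS](mulr0 d.-1%:R) -EF; ring.
have fr0 : fr = 0.
  apply: (mulfI (natr_neq0 d1)); rewrite mulr0 -Er; apply/eqP.
  rewrite -[_ == _]andTb -sqrf_eq0 /=; apply/eqP; rewrite -[RHS](mulr0 al) -iso.
  transitivity (al * (y * (y * al) + z * (y * be) *+ 2) + z ^+ 2 * (be * be)); first by ring.
  by rewrite -det0; ring.
have fs0 : fs = 0.
  apply: (mulfI (natr_neq0 d1)); rewrite mulr0 -Es; apply/eqP.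
  rewrite -[_ == _]andTb -sqrf_eq0 /=; apply/eqP; rewrite -[RHS](mulr0 ga) -iso.
  transitivity (ga * (z * (z * ga) + z * (y * be) *+ 2) + y ^+ 2 * (be * be)); first by ring.
  by rewrite -det0; ring.
apply: (smooth_dird smF Q0 FQ) => w; have [a [b [c ->]]] := span w.
rewrite -addrA -[b *: r + _]scale1r !meval_dirdD -/fr -/fs fr0 fs0 Em mevalM.
by rewrite exprS /L mevalM meval_lform lQ !(mul0r, mulr0, addr0).
Qed.

(** If the axes coincide, a combination [q] of the centers lies on the common axis, and [l] divides
    [dird q F]. So [F(q) = 0] by Euler, and by symmetry of second derivatives the gradient of [F] at
    [q] is proportional to [l]. It vanishes along [p], where [l] is 1, hence [q] is singular. *)
Lemma axes_distinct (l l' : 'cV[K]_3) (p p' : 'rV[K]_3) :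
  (p *m l) ord0 ord0 = 1 -> (p' *m l') ord0 ord0 = 1 ->
  form_dvd l (dird p F) -> form_dvd l' (dird p' F) ->
  (forall c, p != c *: p') -> ~ form_dvd l (lform l').
Proof.
move=> lp lp' [m Em] [m' Em'] pp' [g Eg].
pose a := (p' *m l) ord0 ord0.
have a0 : a != 0.
  apply: contra_eq_neq lp' => a0.
  by rewrite -meval_lform Eg mevalM meval_lform -/a a0 mul0r eq_sym oner_neq0.
pose q := p - a^-1 *: p'.
have q0 : q != 0 by rewrite subr_eq0.
have lq : (q *m l) ord0 ord0 = 0.
  by rewrite mulmxBl -scalemxAl !mxE -/a; move: lp a0; rewrite !mxE /a !mxE => -> a0; rewrite mulVf ?subrr.
have [M EM] : exists M, dird q F = lform l * M.
  exists (m - a^-1 *: (g * m')).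
  have -> : dird q F = dird p F - a^-1 *: dird p' F.
    rewrite /dird scaler_sumr -sumrB; apply: eq_bigr => i _.
    by rewrite !mxE scalerBl scalerA.
  by rewrite Em Em' Eg mulrBr -scalerAr mulrA.
have Fq : F.@[q ord0] = 0.
  have := dird_euler q homF; rewrite EM mevalM meval_lform lq mul0r => /esym/eqP.
  by rewrite mulf_eq0 (negPf (natr_neq0 (ltnW d_gt1))) => /eqP.
have dq w : (d.-1)%:R * (dird w F).@[q ord0] = (w *m l) ord0 ord0 * M.@[q ord0].
  rewrite -(dird_euler q (dhomog_dird w homF)) dird_comm EM dirdM mevalD !mevalM.
  by rewrite meval_lform lq mul0r addr0 dird_form mevalC.
have d1 : (0 < d.-1)%N by lia.
apply: (smooth_dird smF q0 Fq) => w; apply/(mulfI (natr_neq0 d1)).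
rewrite mulr0 dq; have := dq p; rewrite lp mul1r => <-.
by rewrite Em mevalM meval_lform lq mul0r !mulr0.
Qed.

Lemma homology_form_dvd N zeta (l : 'cV[K]_3) (p : 'rV[K]_3) : (1 < N)%N ->
  N.-primitive_root zeta -> (p *m l) ord0 ord0 = 1 ->
  (forall v : 'rV[K]_3, F.@[(v + ((zeta - 1) * (v *m l) ord0 ord0) *: p) ord0] = F.@[v ord0]) ->
  form_dvd l (dird p F).
Proof.
move=> N1 prim lp H; have [g ->] := homology_dird lp N1 prim H.
by exists (lform l ^+ N.-2 * g); rewrite mulrA -exprS; congr (_ ^+ _ * _); lia.
Qed.

(* The [(N i - 2)]-th powers of the axes are coprime divisors of the Hessian. *)
Lemma flex_bound (I : finType) (p : I -> 'rV[K]_3) (N : I -> nat) :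
  (forall i, F.@[p i ord0] != 0) -> (forall i, (1 < N i)%N) ->
  (forall i, homology F (N i) (p i)) ->
  (forall i j, i != j -> forall c, p i != c *: p j) ->
  (\sum_i (N i - 2) <= 3 * (d - 2))%N.
Proof.
move=> Fp N1 /choice[zeta /choice[l H]] pp.
have prim i : (N i).-primitive_root (zeta i) by case: (H i).
have lp i : (p i *m l i) ord0 ord0 = 1 by case: (H i).
have inv i v := let: And3 _ _ E := H i in E v.
have [i0 _|I0] := pickP I; last by rewrite big_pred0.
have dvd i := homology_form_dvd (N1 i) (prim i) (lp i) (inv i).
have H0 : \det hess != 0 := hess_neq0 (lp i0) (Fp i0) (dvd i0).
have p0 i : p i != 0.
  by apply: contra_eq_neq (lp i) => ->; rewrite mul0mx mxE eq_sym oner_neq0.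
have dvdH i := hess_dvd (p0 i) (N1 i) (homology_dird (lp i) (N1 i) (prim i) (inv i)).
have ndvd i j : i != j -> ~ form_dvd (l i) (lform (l j)).
  by move=> ij; apply: (axes_distinct (lp i) (lp j) (dvd i) (dvd j) (pp i j ij)).
pose L i := lform (l i) ^+ (N i - 2).
(* The powers are divided out one axis at a time: a form is prime and divides none of the others,
   hence not their product. *)
have [g Eg] : exists g, \det hess = \prod_i L i * g.
  have : uniq (index_enum I) by apply: index_enum_uniq.
  elim: (index_enum I) => [_|i s IHs /= /andP[iNs us]].
    by exists (\det hess); rewrite big_nil mul1r.
  have [g Eg] := IHs us; have [g' Eg'] := dvdH i.
  have [||h Eh] := @form_exp_dvd _ (l i) (p i) (lp i) (N i - 2) (\prod_(j <- s) L j) g.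
  - elim: s iNs {us IHs Eg} => [|j s IHs]; first by rewrite big_nil => _; apply: form_ndvd1 (lp i).
    rewrite inE negb_or big_cons => /andP[ij /IHs iNs] /(form_prime (lp i))[] //.
    by apply: (form_ndvd_exp (lp i)); apply: ndvd.
  - by exists g'; rewrite -Eg.
  by exists h; rewrite Eg Eh big_cons -/(L i); ring.
have g0 : g != 0 by apply: contraNneq H0 => g0; rewrite Eg g0 mulr0.
have lb s : (\sum_(i <- s) (N i - 2) + msize g <= msize (\prod_(i <- s) L i * g))%N.
  elim: s => [|i s IHs]; first by rewrite !big_nil mul1r.
  rewrite !big_cons -mulrA -addnA.
  apply: leq_trans (msize_form_exp (lp i) (N i - 2) _); first by rewrite leq_add2l.
  rewrite mulf_neq0 // prodf_seq_neq0; apply/allP => j _ /=.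
  by rewrite expf_neq0 ?(lform_neq0 (lp j)).
have := lb (index_enum I); rewrite -Eg.
have -> : msize (\det hess) = (3 * (d - 2)).+1.
  have /dhomogP/(_ _ (mlead_supp H0)) /= <- := hess_homog.
  by rewrite mlead_deg.
have : (0 < msize g)%N by rewrite lt0n msize_poly_eq0.
lia.
Qed.

(** Conjugating a homology by a linear map that preserves [F] moves its center by the map and pulls
    its axis back by the inverse. The map here is the [k]-th power of the homology of center [p]. *)
Lemma homology_orbit N (p : 'rV[K]_3) zeta (l : 'cV[K]_3) N' (p' : 'rV[K]_3) k :
  N.-primitive_root zeta -> (p *m l) ord0 ord0 = 1 ->
  (forall v : 'rV[K]_3, F.@[(v + ((zeta - 1) * (v *m l) ord0 ord0) *: p) ord0] = F.@[v ord0]) ->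
  homology F N' p' ->
  homology F N' (p' + ((zeta ^+ k - 1) * (p' *m l) ord0 ord0) *: p) /\
  F.@[(p' + ((zeta ^+ k - 1) * (p' *m l) ord0 ord0) *: p) ord0] = F.@[p' ord0].
Proof.
move=> prim lp H.
have lD a v : ((v + a *: p) *m l) ord0 ord0 = (v *m l) ord0 ord0 + a.
  by rewrite mulmxDl -scalemxAl mxE [X in _ + X]mxE lp mulr1.
pose s k (v : 'rV[K]_3) := v + ((zeta ^+ k - 1) * (v *m l) ord0 ord0) *: p.
have sD i j v : s (i + j)%N v = s i (s j v).
  rewrite /s lD -addrA -scalerDl exprD; congr (_ + _ *: _); ring.
have sF i v : F.@[(s i v) ord0] = F.@[v ord0].
  elim: i => [|i IHi]; first by rewrite /s expr0 subrr mul0r scale0r addr0.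
  by rewrite -[i.+1]add1n sD {1}/s expr1 H.
have sK i : exists j, forall v, s j (s i v) = v /\ s i (s j v) = v.
  (* The exponents [i] and [i * N.-1] add up to a multiple of [N]. *)
  exists (i * N.-1)%N => v; rewrite -!sD.
  have N0 := prim_order_gt0 prim.
  have E : zeta ^+ (i * N.-1 + i) = 1.
    by rewrite -mulnSr prednK // mulnC exprM (prim_expr_order prim) expr1n.
  by rewrite [(i + _)%N]addnC /s E subrr mul0r scale0r addr0.
move=> [z' [l' [prim' lp' H']]]; split; last exact: sF.
have [j Ej] := sK k.
pose M := 1%:M + (zeta ^+ j - 1) *: (l *m p) : 'M[K]_3.
have sM v : s j v = v *m M.
  rewrite mulmxDr mulmx1 -scalemxAr mulmxA [v *m l]mx11_scalar mul_scalar_mx.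
  by rewrite scalerA.
exists z', (M *m l'); split=> //.
  by rewrite mulmxA -sM (Ej p').1.
move=> v; rewrite mulmxA -sM.
set c := _ * _.
have sL u w : s k (u + c *: w) = s k u + c *: s k w.
  have E : ((u + c *: w) *m l) ord0 ord0 = (u *m l) ord0 ord0 + c * (w *m l) ord0 ord0.
    by rewrite mulmxDl -scalemxAl mxE [X in _ + X]mxE.
  rewrite /s E scalerDr scalerA addrACA -scalerDl; congr (_ + _ *: _); ring.
have -> : v + c *: s k p' = s k (s j v + c *: p') by rewrite sL (Ej v).2.
by rewrite sF H' sF.
Qed.

End Hessian.

(** * Counting quasi-Galois points *)

(** Bounding the finite duplicate-free lists also excludes the value [+oo], an infinite set having
    arbitrarily large finite subsets. *)
Lemma counting_le (T : choiceType) (R : realType) (S : set T) (m : nat) :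
  (forall s : seq T, uniq s -> (forall x, x \in s -> S x) -> (size s <= m)%N) ->
  (counting S <= m%:R%:E :> \bar R)%E.
Proof.
move=> H; rewrite /counting; case: asboolP => [fS|/(infinite_set_fset m.+1)[B BS mB]].
  rewrite lee_fin ler_nat; apply: H => [|x]; first exact: fset_uniq.
  by rewrite in_fset_set // inE.
have := H (enum_fset B) (fset_uniq B) (fun x xB => BS x xB).
by move=> Bm; have := leq_trans mB Bm; rewrite ltnn.
Qed.

Lemma coords_inj (K : fieldType) (P Q : ppoint K) c : coords P = c *: coords Q -> P = Q.
Proof.
move=> E; have span (R : ppoint K) : val R = <[coords R]>%VS.
  apply/esym/eqP; rewrite eqEdim; apply/andP; split; first by rewrite -memvE memv_pick.
  by rewrite dim_vline coords_neq0 (eqP (valP R)).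
apply/val_inj/eqP; rewrite eqEdim (eqP (valP P)) (eqP (valP Q)) leqnn andbT.
by rewrite (span P) (span Q) -memvE E memvZ ?memv_line.
Qed.

Section Points.
Variable K : closedFieldType.
Hypothesis charK0 : [pchar K] =i pred0.
Variables (d : nat) (F : {mpoly K[3]}).
Hypothesis d_gt1 : (1 < d)%N.
Hypothesis smF : smooth_plane_curve d F.

Let homF : F \is d.-homog. Proof. by case: smF. Qed.

Lemma point_bound (t : seq (nat * ppoint K)) : uniq [seq x.2 | x <- t] ->
  (forall x, x \in t -> [/\ (1 < x.1)%N, ~ on_curve F x.2 & `I_x.1 #<= galois_group F x.2]) ->
  (\sum_(x <- t) (x.1 - 2) <= 3 * (d - 2))%N.
Proof.
move=> ut H; pose P (i : 'I_(size t)) := tnth (in_tuple t) i.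
have Pt i : P i \in t by apply: mem_tnth.
have hom i : exists Nk : nat * K, [/\ ((P i).1 <= Nk.1)%N, Nk.2 != 0 &
    homology F Nk.1 (Nk.2 *: coords (P i).2)].
  have [n1 FP gP] := H _ (Pt i).
  by have [N [k H']] := galois_homology charK0 d_gt1 smF FP n1 gP; exists (N, k).
have [Nk HNk] := choice hom.
rewrite big_tnth; apply: leq_trans (@flex_bound K charK0 d F d_gt1 smF _
    (fun i => (Nk i).2 *: coords (P i).2) (fun i => (Nk i).1) _ _ _ _).
- by apply: leq_sum => i _; apply: leq_sub2r; case: (HNk i).
- move=> i; have [_ k0 _] := HNk i; have [_ /eqP FP _] := H _ (Pt i).
  by rewrite (dhomog_scale _ _ homF) mulf_neq0 ?expf_neq0.
- by move=> i; have [n1 _ _] := H _ (Pt i); have [nN _ _] := HNk i; apply: leq_trans nN.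
- by move=> i; case: (HNk i).
- move=> i j ij c; have [_ k0 _] := HNk i; apply: contra ij => /eqP E.
  have Pij : (P i).2 = (P j).2.
    apply: (@coords_inj _ _ _ ((Nk i).2^-1 * (c * (Nk j).2))).
    by rewrite -!scalerA -E scalerA mulVf // scale1r.
  have sz : size t = size [seq x.2 | x <- t] by rewrite size_map.
  have nthP (k : 'I_(size t)) : (P k).2 = nth (P i).2 [seq x.2 | x <- t] k.
    by rewrite (nth_map (P i)) // /P (tnth_nth (P i)).
  apply/eqP/val_inj/eqP; rewrite /= -(nth_uniq (P i).2 _ _ ut) -?sz //.
  by rewrite -!nthP Pij.
Qed.

(* If [P j] is not on the axis of [P i], the orbit of [P j] under the homology
   of center [P i] and [P i] itself violate [flex_bound]. *)
Lemma four_points n (P : 'I_4 -> ppoint K) : injective P -> (1 < n)%N ->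
  (forall i, ~ on_curve F (P i) /\ `I_n #<= galois_group F (P i)) ->
  ((n + 1) * (n - 2) <= 3 * (d - 2))%N.
Proof.
move=> injP n1 H; rewrite leqNgt; apply/negP => big.
have hom i : exists Nk : nat * K, [/\ (n <= Nk.1)%N, Nk.2 != 0 &
    homology F Nk.1 (Nk.2 *: coords (P i))].
  have [FP gP] := H i.
  by have [N [k H']] := galois_homology charK0 d_gt1 smF FP n1 gP; exists (N, k).
have [Nk HNk] := choice hom.
pose p i := (Nk i).2 *: coords (P i); pose N i := (Nk i).1.
have nN i : (n <= N i)%N by case: (HNk i).
have Hp i : homology F (N i) (p i) by case: (HNk i).
have Fp i : F.@[p i ord0] != 0.
  have [_ k0 _] := HNk i; have [/eqP FP _] := H i.
  by rewrite (dhomog_scale _ _ homF) mulf_neq0 ?expf_neq0.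
have pp i j : i != j -> forall c, p i != c *: p j.
  move=> ij c; have [_ k0 _] := HNk i; apply: contra ij => /eqP E; apply/eqP/injP.
  apply: (@coords_inj _ _ _ ((Nk i).2^-1 * (c * (Nk j).2))).
  by rewrite -!scalerA -/(p j) -E scalerA mulVf // scale1r.
have [zeta /choice[l Hl]] := choice Hp.
have lp i : (p i *m l i) ord0 ord0 = 1 by case: (Hl i).
have p0 i : p i != 0.
  by apply: contra_eq_neq (lp i) => ->; rewrite mul0mx mxE eq_sym oner_neq0.
have orth i j : i != j -> (p j *m l i) ord0 ord0 = 0.
  move=> ij; apply/eqP; apply: contraT => lij.
  have [prim _ inv] := Hl i.
  have ji : j != i by rewrite eq_sym.
  pose a k := (zeta i ^+ k - 1) * (p j *m l i) ord0 ord0.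
  have orb k := homology_orbit k prim (lp i) inv (Hp j).
  (* [None] stands for the center and [Some k] for a point of the orbit: [n + 1] points in all, each
     contributing at least [n - 2]. *)
  pose q (x : option 'I_n) := if x is Some k then p j + a k *: p i else p i.
  pose M (x : option 'I_n) := if x is Some k then N j else N i.
  have : (\sum_x (M x - 2) <= 3 * (d - 2))%N.
    apply: (flex_bound charK0 d_gt1 smF (p := q)).
    - by move=> [k|] //=; rewrite (orb k).2.
    - by move=> [k|] /=; apply: leq_trans (nN _).
    - by move=> [k|] //=; apply: (orb k).1.
    - move=> [k|] [k'|] //= kk' c; apply/eqP.
      (* For [c = 1] two powers of [zeta i] with exponents less than [n <= N i] agree; any other
         relation makes [p j] a multiple of [p i]. *)
      + have [->|c1] := eqVneq c 1.
          rewrite scale1r => /addrI/eqP; rewrite -subr_eq0 -scalerBl scaler_eq0 (negPf (p0 i)) orbF.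
          rewrite /a -mulrBl mulf_eq0 (negPf lij) orbF opprB addrA subrK subr_eq0.
          rewrite (eq_prim_root_expr prim) !modn_small ?(leq_trans (ltn_ord _)) // => /eqP kk.
          by case/eqP: kk'; congr Some; apply/val_inj.
        move=> E; have c1' : 1 - c != 0 by rewrite subr_eq0 eq_sym.
        have /eqP[] := pp j i ji ((1 - c)^-1 * (c * a k' - a k)).
        rewrite -scalerA scalerBl -scalerA.
        have -> : c *: (a k' *: p i) - a k *: p i = (1 - c) *: p j.
          have -> : c *: (a k' *: p i) = p j + a k *: p i - c *: p j.
            by rewrite E scalerDr addrC addKr.
          by rewrite addrAC addrK scalerBl scale1r.
        by rewrite scalerA mulVf // scale1r.
      + move=> E; have /eqP[] := pp j i ji (c - a k).
        by rewrite scalerBl -E addrK.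
      + move=> E; have c0 : c != 0.
          by apply: contraNneq (p0 i) => c0; rewrite E c0 scale0r.
        have /eqP[] := pp j i ji (c^-1 - a k').
        by rewrite scalerBl {1}E scalerA mulVf // scale1r addrK.
  have : ((n + 1) * (n - 2) <= \sum_x (M x - 2))%N.
    rewrite addn1 -{1}[n]card_ord -card_option -sum_nat_const.
    by apply: leq_sum => -[k|] _; apply: leq_sub2r; apply: nN.
  by move=> h1 h2; have := leq_trans h1 h2; rewrite leqNgt big.
(* The four centers and their axes are now dual families in dimension three, so the identity of size
   4 would factor through dimension 3. *)
pose A : 'M[K]_(4, 3) := \matrix_i p i.
pose B : 'M[K]_(3, 4) := \matrix_(i, j) l j i ord0.
have : A *m B = 1%:M.
  apply/matrixP => i j; have -> : (A *m B) i j = (p i *m l j) ord0 ord0.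
    by rewrite !mxE; apply: eq_bigr => k _; rewrite !mxE.
  by rewrite [RHS]mxE; case: eqVneq => [->|ij]; rewrite ?lp // orth // eq_sym.
by move/mulmx1_min.
Qed.

End Points.

Theorem theorem4p8 (R : realType) (K : closedFieldType)
    (charK0 : [pchar K] =i pred0) (d : nat) (d_ge4 : (4 <= d)%N)
    (F : {mpoly K[3]}) (smoothF : smooth_plane_curve d F) :
  (\sum_(3 <= n <oo) delta' R F n * (n - 2)%N%:R%:E
     <= (3 * (d - 2))%N%:R%:E)%E /\
  (forall n : nat, (2 <= n)%N ->
     ((n + 1) * (n - 2) > 3 * (d - 2))%N ->
     (delta'_ge R F n <= 3%:R%:E)%E).
Proof.
have d_gt1 : (1 < d)%N by apply: leq_trans d_ge4.
split=> [|n n2 big]; last first.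
  apply: counting_le => s us sS; rewrite leqNgt; apply/negP => s4.
  have [P0 _] : exists x, x \in s by case: s s4 {us sS} => // x s _; exists x; rewrite inE eqxx.
  pose P (i : 'I_4) := nth P0 s i.
  have lt4 (i : 'I_4) : (i < size s)%N by apply: leq_trans s4.
  have injP : injective P.
    by move=> i j /eqP; rewrite nth_uniq // => /eqP/val_inj.
  have := four_points charK0 d_gt1 smoothF injP n2.
  rewrite leqNgt big => /(_ _)/negP; apply => // i.
  by have [_ FP gP] := sS _ (mem_nth P0 (lt4 i)).
pose S n : set (ppoint K) :=
  [set P | [/\ quasi_galois F P, ~ on_curve F P & galois_group F P #= `I_n]]%classic.
have galS n P : S n P -> `I_n #<= galois_group F P.
  by move=> [_ _ gP]; rewrite (card_le_eqr gP) card_lexx.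
(* Each point contributes [n - 2 >= 1] to the bound, so an infinite set, counted as [+oo], is
   impossible. *)
have finS n : (3 <= n)%N -> finite_set (S n).
  move=> n3; apply: contrapT => /(infinite_set_fset (3 * (d - 2)).+1)[B BS mB].
  have := @point_bound K charK0 d F d_gt1 smoothF [seq (n, P) | P <- enum_fset B].
  rewrite big_map big_const_seq count_predT iter_addn_0 -map_comp map_id => H.
  have : ((n - 2) * size (enum_fset B) <= 3 * (d - 2))%N.
    apply: H => [|_ /mapP[P PB ->]]; first exact: fset_uniq.
    have SP := BS _ PB; split=> /=; [exact: ltnW|by case: SP|exact: galS].
  have : (size (enum_fset B) <= (n - 2) * size (enum_fset B))%N.
    by rewrite leq_pmull // subn_gt0.
  by move=> h1 h2; have := leq_trans mB (leq_trans h1 h2); rewrite ltnn.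
apply: lime_le.
  apply: is_cvg_nneseries => n _ _; apply: mule_ge0; last by rewrite lee_fin.
  by rewrite /delta' /counting; case: ifP; rewrite ?lee_fin ?leey.
near=> M.
have partial : (\sum_(3 <= n < M) size (fset_set (S n)) * (n - 2) <= 3 * (d - 2))%N.
  (* All points with group order from 3 to [M - 1] are put in one list. A point occurs once, since
     it determines the order of its group; so the bound applies to the whole partial sum. *)
  pose t := [seq (n, P) | n <- index_iota 3 M, P <- enum_fset (fset_set (S n))].
  have tS x : x \in t -> (3 <= x.1)%N /\ S x.1 x.2.
    move=> /allpairsPdep[n [P [+ + ->]]]; rewrite mem_index_iota => /andP[n3 _].
    by rewrite in_fset_set ?inE //; apply: finS.
  have ut : uniq [seq x.2 | x <- t].
    rewrite map_inj_in_uniq; last first.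
      move=> [n P] [n' P'] /tS[_ [_ _ /= g1]] /tS[_ [_ _ /= g2]] /= E; rewrite -E in g2 *.
      by congr (_, _); apply/card_eq_II; rewrite card_eq_sym in g1; apply: card_eq_trans g1 g2.
    apply: allpairs_uniq_dep; [exact: iota_uniq|by move=> n _; apply: fset_uniq|].
    by move=> [n P] [n' P'] _ _ /= [-> ->].
  have := @point_bound K charK0 d F d_gt1 smoothF t ut.
  rewrite big_allpairs_dep /= => H.
  under eq_bigr => n _ do rewrite mulnC -sum1_size big_distrr /=.
  under eq_bigr => n _ do under eq_bigr => P _ do rewrite muln1.
  apply: H => -[n P] /tS[/= n3 SP]; split; [exact: ltnW|by case: SP|exact: galS].
have cE n : (3 <= n)%N -> delta' R F n = (size (fset_set (S n)))%:R%:E.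
  by move=> n3; rewrite /delta' /counting asboolT //; apply: finS.
rewrite (eq_big_nat _ _ (F2 := fun n => (size (fset_set (S n)) * (n - 2))%N%:R%:E)).
  by rewrite sumEFin -natr_sum lee_fin ler_nat.
by move=> n /andP[n3 _]; rewrite cE // -EFinM natrM.
Unshelve. all: by end_near.
Qed.
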